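(* Suppose $\mu>0$, i.e. $f$ is strongly convex on $\mathrm{dom}(P)$. Consider Algorithm 2 (described in the context) with input parameters $\epsilon,M,\delta,\alpha_0,\gamma_0$, applied to $\min_xF(x)$, $F=f+P$. Let $$T=M+\left\lceil\frac{2\log\frac{\epsilon}{r_0\left(\sqrt{2\max\{\gamma_0^{-1},L_{\widehat{\mathcal S}}\delta^{-1}\}}+\sqrt{2\gamma_0}L_{\widehat{\mathcal S}}\right)}}{\log\left(1-\sqrt{\mu\min\{\gamma_0,\delta L_{\widehat{\mathcal S}}^{-1}\}}\right)}\right\rceil_+,$$ $$\bar N=(1+M^{-1})\left(M+\left\lceil\frac{2\log\frac{\epsilon}{r_0\left(\sqrt{2\max\{\gamma_0^{-1},L_{\widehat{\mathcal S}}\delta^{-1}\}}+\sqrt{2\gamma_0}L_{\widehat{\mathcal S}}\right)}}{\log\left(1-\sqrt{\mu\min\{\gamma_0,\delta L_{\widehat{\mathcal S}}^{-1}\}}\right)}\right\rceil_+\right)\left(1+\left\lceil\frac{\log(\gamma_0L_{\widehat{\mathcal S}})}{\log(1/\delta)}\right\rceil_+\right).$$ Then Algorithm 2 terminates and outputs an $\epsilon$-residual solution of $\min_xF(x)$ (a point $x$ with $\mathrm{dist}(0,\partial F(x))\le\epsilon$) in at most $T$ iterations. Moreover, the total number of evaluations of $\nabla f$ and the total number of evaluations of the proximal operator of $P$ performed in Algorithm 2 are each no more than $\bar N$.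
   Context: Problem. $f,P:\mathbb R^n\to(-\infty,\infty]$ are proper closed convex functions, $f$ is differentiable on $\mathrm{cl}(\mathrm{dom}(P))$, and $\nabla f$ is locally Lipschitz continuous on $\mathrm{cl}(\mathrm{dom}(P))$; $\mathrm{dom}(P)$ may be unbounded. (A map $\nabla h$ is locally Lipschitz continuous on $\Omega$ if for every $x\in\Omega$ there are $L_x>0$ and an open set $U_x\ni x$ such that $\nabla h$ is $L_x$-Lipschitz continuous on $U_x$.) $F=f+P$, $F^*=\min_xF(x)\in\mathbb R$ is attained, and $x^*$ is an arbitrary fixed minimizer of $F$. $\mu$ is the convexity parameter of $f$ on $\mathrm{dom}(P)$: $f(y)\ge f(x)+\langle\nabla f(x),y-x\rangle+\frac\mu2\|x-y\|^2$ for all $x\in\mathrm{dom}(P)$, $y\in\mathbb R^n$. The proximal operator of $P$ can be evaluated exactly; an evaluation of the proximal operator of $\gamma P$, $\gamma>0$, counts as one evaluation of the proximal operator of $P$. $\|\cdot\|$ is the Euclidean norm and $\mathrm{dist}$ the Euclidean distance. Algorithm 2. Input: $\epsilon>0$, $\gamma_0\in(0,1/\mu]$, $0<\alpha_0\in[\sqrt{\mu\gamma_0},1]$, $\delta\in(0,1)$, a positive integer $M$, $x^1=z^1\in\mathrm{dom}(P)$. For $t=1,2,\dots$: Compute $y^t=\big((1-\alpha_t)x^t+\alpha_t(1-\beta_t)z^t\big)/(1-\alpha_t\beta_t)$, $z^{t+1}=\arg\min_x\{\gamma_t[\langle\nabla f(y^t),x\rangle+P(x)]+\frac{\alpha_t}2\|x-\beta_ty^t-(1-\beta_t)z^t\|^2\}$,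 $x^{t+1}=(1-\alpha_t)x^t+\alpha_tz^{t+1}$, where $\gamma_t=\gamma_0\delta^{n_t}$, $\beta_t=\mu\gamma_t\alpha_t^{-1}$, $\alpha_t\in(0,1]$ is the solution of $\gamma_{t-1}\alpha_t^2=(1-\alpha_t)\alpha_{t-1}^2\gamma_t+\mu\alpha_t\gamma_t\gamma_{t-1}$, and $n_t$ is the smallest non-negative integer such that $2\gamma_t\big(f(x^{t+1})-f(y^t)-\langle\nabla f(y^t),x^{t+1}-y^t\rangle\big)\le\|x^{t+1}-y^t\|^2$. If $t$ is a multiple of $M$: call Algorithm 3 with input $(x^{t+1},\gamma_0,\delta)$, denote its output $(\tilde x^{t+1},\tilde\gamma_{t+1})$, and terminate with output $\tilde x^{t+1}$ if $\|\tilde\gamma_{t+1}^{-1}(x^{t+1}-\tilde x^{t+1})+\nabla f(\tilde x^{t+1})-\nabla f(x^{t+1})\|\le\epsilon$. Algorithm 3. Input $(v,\tilde\gamma_0,\delta)$ with $v\in\mathcal S$ (defined below) and $\tilde\gamma_0,\delta>0$. Output $(\tilde v,\tilde\gamma)$ where $\tilde v=\arg\min_x\{\tilde\gamma\langle\nabla f(v),x\rangle+\tilde\gamma P(x)+\frac12\|x-v\|^2\}$, $\tilde\gamma=\tilde\gamma_0\delta^{\tilde n}$, and $\tilde n$ is the smallest non-negative integer such that $2\tilde\gamma(f(\tilde v)-f(v)-\langle\nabla f(v),\tilde v-v\rangle)\le\|\tilde v-v\|^2$. Constants. $r_0=\sqrt{F(x^1)-F(x^* )+\frac{\alpha_0^2}{2\gamma_0}\|x^1-x^*\|^2}$;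 $\mathcal S=\{x\in\mathrm{dom}(P):\|x-x^*\|\le\sqrt{2\gamma_0}\,r_0/\alpha_0\}$; $L_{\mathcal S}>0$ is a Lipschitz constant of $\nabla f$ on $\mathcal S$ (it exists); $\widehat{\mathcal S}=\{x\in\mathrm{dom}(P):\|x-x^*\|\le(1+\gamma_0L_{\mathcal S})\sqrt{2\gamma_0}\,r_0/\alpha_0\}$; $L_{\widehat{\mathcal S}}>0$ is a Lipschitz constant of $\nabla f$ on $\widehat{\mathcal S}$ (it exists). $\lceil\omega\rceil_+=\max\{\lceil\omega\rceil,0\}$.
   Formalization: If γ0·L_Ŝ ≤ 1, the bound N̄ on gradient evaluations is proved without counting the gradients at x̃^{t+1} in the stopping test (counting them makes the claim false); if γ0·L_Ŝ > 1 all are counted. Where y^t is 0/0, any convex combination of x^t and z^t is allowed. *)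

(* Defs.v *)
From HB Require Import structures.
From mathcomp Require Import all_boot all_order all_algebra.
From mathcomp Require Import all_classical all_reals all_analysis.
Set Implicit Arguments.
Unset Strict Implicit.
Unset Printing Implicit Defensive.
Import Order.TTheory GRing.Theory Num.Theory.
Import numFieldNormedType.Exports.
Local Open Scope classical_set_scope.
Local Open Scope ring_scope.

(* The norm `|_| of 'rV[R]_n is the sup norm: it is used only through the
   topology and the derivative, every metric quantity uses enorm. *)
Definition dot (R : realType) (n : nat) (u v : 'rV[R]_n) : R :=
  \sum_(i < n) u 0 i * v 0 i.

Definition enorm (R : realType) (n : nat) (u : 'rV[R]_n) : R :=
  Num.sqrt (dot u u).

(* +oo when A is empty *)
Definition edist (R : realType) (n : nat) (x : 'rV[R]_n) (A : set 'rV[R]_n)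
    : \bar R :=
  ereal_inf [set (enorm (g - x))%:E | g in A].

Definition dom (R : realType) (n : nat) (h : 'rV[R]_n -> \bar R)
    : set 'rV[R]_n :=
  [set x | (h x < +oo)%E].

Definition proper (R : realType) (n : nat) (h : 'rV[R]_n -> \bar R) : Prop :=
  (forall x, h x <> -oo%E) /\ (exists x, dom h x).

Definition convex (R : realType) (n : nat) (h : 'rV[R]_n -> \bar R) : Prop :=
  forall (x y : 'rV[R]_n) (s : R), 0 <= s <= 1 ->
    (h (s *: x + (1 - s) *: y)%R <= s%:E * h x + (1 - s)%R%:E * h y)%E.

(* closedness of a proper function is lower semicontinuity *)
Definition proper_closed_convex (R : realType) (n : nat)
    (h : 'rV[R]_n -> \bar R) : Prop :=
  [/\ proper h, lower_semicontinuous h & convex h].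

(* An extended-valued function differentiable at x is finite around x. *)
Definition ediff (R : realType) (n : nat) (h : 'rV[R]_n -> \bar R)
    (x : 'rV[R]_n) : Prop :=
  (\forall y \near x, h y \is a fin_num) /\ differentiable (fine \o h) x.

(* meaningful only where h is ediff *)
Definition grad (R : realType) (n : nat) (h : 'rV[R]_n -> \bar R)
    (x : 'rV[R]_n) : 'rV[R]_n :=
  \row_(i < n) ('d (fine \o h) x (delta_mx 0 i) : R).

Definition lipschitz_const (R : realType) (n : nat) (L : R)
    (A : set 'rV[R]_n) (g : 'rV[R]_n -> 'rV[R]_n) : Prop :=
  forall x y, A x -> A y -> enorm (g x - g y) <= L * enorm (x - y).

Definition locally_lipschitz_grad (R : realType) (n : nat)
    (h : 'rV[R]_n -> \bar R) (Omega : set 'rV[R]_n) : Prop :=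
  forall x, Omega x -> exists (L : R) (U : set 'rV[R]_n),
    [/\ 0 < L, open U, U x, (forall y, U y -> ediff h y) &
        lipschitz_const L U (grad h)].

Definition convexity_parameter (R : realType) (n : nat) (mu : R)
    (h : 'rV[R]_n -> \bar R) (A : set 'rV[R]_n) : Prop :=
  forall x y, A x ->
    (h x + (dot (grad h x) (y - x) + mu / 2 * enorm (x - y) ^+ 2)%R%:E
       <= h y)%E.

Definition is_argmin (R : realType) (n : nat) (phi : 'rV[R]_n -> \bar R)
    (z : 'rV[R]_n) : Prop :=
  forall w, (phi z <= phi w)%E.

Definition subdiff (R : realType) (n : nat) (h : 'rV[R]_n -> \bar R)
    (x : 'rV[R]_n) : set 'rV[R]_n :=
  [set g | forall y, (h x + (dot g (y - x))%R%:E <= h y)%E].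

Definition residual_solution (R : realType) (n : nat)
    (h : 'rV[R]_n -> \bar R) (eps : R) (x : 'rV[R]_n) : Prop :=
  (edist 0 (subdiff h x) <= eps%:E)%E.

(* tests counts the gradients at the candidate output needed by the stopping
   criterion; grads counts all the other gradients. They are kept apart because
   grads + tests can exceed evaluation_bound when gamma0 * L <= 1: for
   f = x^2/2, P = 0 on the line, mu = L = 1, gamma0 = 1/4, alpha0 = 1/2, M = 1
   and eps large, the bound is 2 and three distinct gradients are needed. *)
Record tally := Tally { grads : nat; proxs : nat; tests : nat }.

Definition tally0 := Tally 0 0 0.
Definition add_grad (c : tally) := Tally (grads c).+1 (proxs c) (tests c).
Definition add_prox (c : tally) := Tally (grads c) (proxs c).+1 (tests c).
Definition add_test (c : tally) := Tally (grads c) (proxs c) (tests c).+1.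

(* Main t k a g x z c : in iteration t, the value k is about to be tried for
     n_t; a = alpha_(t-1), g = gamma_(t-1), x = x^t, z = z^t.
   Check t k a g v z c : in iteration t, the residual procedure called with
     v = x^(t+1) is about to try the value k for its line-search exponent;
     a = alpha_t, g = gamma_t, z = z^(t+1).
   Done t w c : the method has stopped in iteration t with output w. *)
Inductive config (R : realType) (n : nat) : Type :=
| Main (t k : nat) (a g : R) (x z : 'rV[R]_n) (c : tally)
| Check (t k : nat) (a g : R) (v z : 'rV[R]_n) (c : tally)
| Done (t : nat) (w : 'rV[R]_n) (c : tally).
Arguments Main {R n}.
Arguments Check {R n}.
Arguments Done {R n}.

(* If alpha * beta = 1 (which forces alpha = beta = 1, gamma = gamma_0 = 1/mu)
   the defining quotient is 0/0.  Otherwise it is a convex combination of x and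
   z, so in the exceptional case any convex combination is allowed. *)
Definition extrapolation (R : realType) (n : nat) (alpha beta : R)
    (x z y : 'rV[R]_n) : Prop :=
  if alpha * beta == 1
  then exists2 s : R, 0 <= s <= 1 & y = (1 - s) *: x + s *: z
  else y = (1 - alpha * beta)^-1 *:
             ((1 - alpha) *: x + (alpha * (1 - beta)) *: z).

Definition main_trial (R : realType) (n : nat) (f P : 'rV[R]_n -> \bar R)
    (mu gamma0 delta : R) (k : nat) (a g : R) (x z : 'rV[R]_n)
    (alpha gamma : R) (y z' x' : 'rV[R]_n) : Prop :=
  let beta := mu * gamma * alpha^-1 in
  [/\ gamma = gamma0 * delta ^+ k,
      0 < alpha <= 1 /\
        g * alpha ^+ 2 =
          (1 - alpha) * a ^+ 2 * gamma + mu * alpha * gamma * g,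
      extrapolation alpha beta x z y,
      is_argmin (fun w => gamma%:E * ((dot (grad f y) w)%:E + P w)
         + (alpha / 2 * enorm (w - beta *: y - (1 - beta) *: z) ^+ 2)%R%:E)%E z' &
      x' = (1 - alpha) *: x + alpha *: z'].

Definition check_trial (R : realType) (n : nat) (f P : 'rV[R]_n -> \bar R)
    (gamma0 delta : R) (k : nat) (v : 'rV[R]_n)
    (gamma : R) (w : 'rV[R]_n) : Prop :=
  gamma = gamma0 * delta ^+ k /\
  is_argmin (fun u => (gamma * dot (grad f v) u)%R%:E + gamma%:E * P u
                      + (2^-1 * enorm (u - v) ^+ 2)%R%:E)%E w.

Definition accepted (R : realType) (n : nat) (f : 'rV[R]_n -> \bar R)
    (gamma : R) (y x : 'rV[R]_n) : Prop :=
  ((2 * gamma)%R%:E * (f x - f y - (dot (grad f y) (x - y))%R%:E)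
     <= (enorm (x - y) ^+ 2)%R%:E)%E.

Definition stopping (R : realType) (n : nat) (f : 'rV[R]_n -> \bar R)
    (eps gamma : R) (v w : 'rV[R]_n) : Prop :=
  enorm (gamma^-1 *: (v - w) + grad f w - grad f v) <= eps.

(* One step performs one trial of one of the two line searches. The gradient
   at v is evaluated once per call of the residual procedure and is reused in
   the stopping criterion. *)
Inductive step (R : realType) (n : nat) (f P : 'rV[R]_n -> \bar R)
    (mu eps gamma0 delta : R) (M : nat) : config R n -> config R n -> Prop :=
| main_reject t k a g x z c alpha gamma y z' x' :
    main_trial f P mu gamma0 delta k a g x z alpha gamma y z' x' ->
    ~ accepted f gamma y x' ->
    step f P mu eps gamma0 delta M (Main t k a g x z c)
      (Main t k.+1 a g x z (add_prox (add_grad c)))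
| main_next t k a g x z c alpha gamma y z' x' :
    main_trial f P mu gamma0 delta k a g x z alpha gamma y z' x' ->
    accepted f gamma y x' ->
    ~~ (M %| t)%N ->
    step f P mu eps gamma0 delta M (Main t k a g x z c)
      (Main t.+1 0 alpha gamma x' z' (add_prox (add_grad c)))
| main_check t k a g x z c alpha gamma y z' x' :
    main_trial f P mu gamma0 delta k a g x z alpha gamma y z' x' ->
    accepted f gamma y x' ->
    (M %| t)%N ->
    step f P mu eps gamma0 delta M (Main t k a g x z c)
      (Check t 0 alpha gamma x' z' (add_grad (add_prox (add_grad c))))
| check_reject t k a g v z c gamma w :
    check_trial f P gamma0 delta k v gamma w ->
    ~ accepted f gamma v w ->
    step f P mu eps gamma0 delta M (Check t k a g v z c)
      (Check t k.+1 a g v z (add_prox c))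
| check_continue t k a g v z c gamma w :
    check_trial f P gamma0 delta k v gamma w ->
    accepted f gamma v w ->
    ~ stopping f eps gamma v w ->
    step f P mu eps gamma0 delta M (Check t k a g v z c)
      (Main t.+1 0 a g v z (add_test (add_prox c)))
| check_stop t k a g v z c gamma w :
    check_trial f P gamma0 delta k v gamma w ->
    accepted f gamma v w ->
    stopping f eps gamma v w ->
    step f P mu eps gamma0 delta M (Check t k a g v z c)
      (Done t w (add_test (add_prox c))).

Definition start (R : realType) (n : nat) (alpha0 gamma0 : R)
    (x1 : 'rV[R]_n) : config R n :=
  Main 1 0 alpha0 gamma0 x1 x1 tally0.

Inductive reachable (A : Type) (rel : A -> A -> Prop) (s0 : A) : A -> Prop :=
| reachable_refl : reachable rel s0 s0
| reachable_step s s' :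
    reachable rel s0 s -> rel s s' -> reachable rel s0 s'.

(* No execution gets stuck before an output is produced, and no execution is
   infinite. *)
Definition terminates (R : realType) (n : nat)
    (rel : config R n -> config R n -> Prop) (s0 : config R n) : Prop :=
  (forall s, reachable rel s0 s ->
     (exists t w c, s = Done t w c) \/ (exists s', rel s s')) /\
  ~ (exists s : nat -> config R n, s 0 = s0 /\ forall i, rel (s i) (s i.+1)).

Definition initial_radius (R : realType) (n : nat) (F : 'rV[R]_n -> \bar R)
    (alpha0 gamma0 : R) (x1 xs : 'rV[R]_n) : R :=
  Num.sqrt (fine (F x1 - F xs)%E
            + alpha0 ^+ 2 / (2 * gamma0) * enorm (x1 - xs) ^+ 2).

Definition dom_ball (R : realType) (n : nat) (P : 'rV[R]_n -> \bar R)
    (xs : 'rV[R]_n) (rho : R) : set 'rV[R]_n :=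
  [set x | dom P x /\ enorm (x - xs) <= rho].

Definition ceilp (R : realType) (w : R) : int := Num.max (Num.ceil w) 0.

(* If r0 = 0 the argument of the outer ln is eps / 0 = 0 and the value is 0, in
   agreement with the limit r0 -> 0; if r0 > 0 every ln has a positive argument
   under the hypotheses on mu, gamma0, delta, L. *)
Definition rate_term (R : realType) (mu eps gamma0 delta r0 L : R) : int :=
  ceilp (2 * ln (eps / (r0 * (Num.sqrt (2 * Num.max gamma0^-1 (L * delta^-1))
                              + Num.sqrt (2 * gamma0) * L)))
         / ln (1 - Num.sqrt (mu * Num.min gamma0 (delta * L^-1)))).

Definition iteration_bound (R : realType) (mu eps gamma0 delta r0 L : R)
    (M : nat) : int :=
  M%:Z + rate_term mu eps gamma0 delta r0 L.

Definition evaluation_bound (R : realType) (mu eps gamma0 delta r0 L : R)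
    (M : nat) : R :=
  (1 + M%:R^-1)
  * (M%:Z + rate_term mu eps gamma0 delta r0 L)%:~R
  * (1 + ceilp (ln (gamma0 * L) / ln (1 / delta)))%:~R.

(* Main.v *)
Require Import Defs.
From HB Require Import structures.
From mathcomp Require Import all_boot all_order all_algebra.
From mathcomp Require Import all_classical all_reals all_analysis.
From mathcomp Require Import ring lra zify.
Set Implicit Arguments.
Unset Strict Implicit.
Unset Printing Implicit Defensive.
Import Order.TTheory GRing.Theory Num.Theory.
Import numFieldNormedType.Exports.
Local Open Scope classical_set_scope.
Local Open Scope ring_scope.

(** Write F = f + P, and let A be the current value of alpha ^ 2 / gamma.  The
    method is an accelerated proximal gradient method, and its analysis rests on
    the potential F(x) - F(xs) + A / 2 * |z - xs| ^ 2.  An accepted iteration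
    multiplies it by at most 1 - alpha ([potential_step]): the line search test is
    an upper quadratic model of f at y, the proximal step minimizes this model
    plus P with quadratic growth ([prox_growth]), and the strong convexity of f at
    y pays for the displacement of the centre from z to beta y + (1 - beta) z.
    The equation that defines alpha is exactly what makes the quadratic terms
    match.

    That equation also shows that A decreases at most by the factor 1 - alpha.
    The product of these factors therefore cancels when the potential is divided
    by A, and all the iterates stay in the ball S ([in_S_of_potential]).  A trial
    point x' may leave S, but the proximal map is nonexpansive and - grad f(xs) is
    a subgradient of P at xs ([xs_subgradient]), so that x' stays in the larger
    ball Sh ([main_trial_facts]).  There grad f is LSh-Lipschitz, the descent lemma
    holds ([descent]), and a line search can refuse gamma only if gamma * LSh > 1.
    This bounds the number of trials by the second logarithmic factor of the
    evaluation bound, and it bounds gamma below by min(gamma0, delta / LSh).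
    Since alpha ^ 2 >= mu * gamma ([alpha_ge]), the potential then decays
    geometrically with ratio at most 1 - q, where
    q = sqrt(mu * min(gamma0, delta / LSh)).

    The vector tested by the stopping criterion is a subgradient of F at the
    output ([stopping_residual]), and its norm is at most a constant times the
    square root of F(v) - F(xs) ([residual_bound]), hence it decays
    geometrically as well.  Taking logarithms, every check made at an iteration
    t >= rate_steps succeeds, and one such check occurs within the next M
    iterations ([iteration_le]).

    The execution is a nondeterministic transition system, so the bounds are
    carried by an [invariant] of its configurations.  Proximal points exist because
    the objective is coercive and lower semicontinuous ([prox_exists]), so no
    execution gets stuck; every transition costs one proximal evaluation, so the
    bound on their number excludes infinite executions. *)

(** * Euclidean geometry of row vectors *)

Section Euclidean.
Context {R : realType} {n : nat}.
Implicit Types (u v w : 'rV[R]_n) (a s : R).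

Lemma dotC u v : dot u v = dot v u.
Proof. by apply: eq_bigr => i _; rewrite mulrC. Qed.

Lemma dotDl u v w : dot (u + v) w = dot u w + dot v w.
Proof. by rewrite -big_split; apply: eq_bigr => i _; rewrite mxE mulrDl. Qed.

Lemma dotZl a u v : dot (a *: u) v = a * dot u v.
Proof. by rewrite /dot mulr_sumr; apply: eq_bigr => i _; rewrite mxE mulrA. Qed.

Lemma dotNl u v : dot (- u) v = - dot u v.
Proof. by rewrite -scaleN1r dotZl mulN1r. Qed.

Lemma dotDr u v w : dot u (v + w) = dot u v + dot u w.
Proof. by rewrite !(dotC u) dotDl. Qed.

Lemma dotZr a u v : dot u (a *: v) = a * dot u v.
Proof. by rewrite !(dotC u) dotZl. Qed.

Lemma dotNr u v : dot u (- v) = - dot u v.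
Proof. by rewrite !(dotC u) dotNl. Qed.

Definition dotE := (dotDl, dotDr, dotZl, dotZr, dotNl, dotNr).

Lemma dot_ge0 u : 0 <= dot u u.
Proof. by apply: sumr_ge0 => i _; rewrite -expr2 sqr_ge0. Qed.

Lemma enorm_ge0 u : 0 <= enorm u.
Proof. exact: sqrtr_ge0. Qed.

Lemma enorm_sqr u : enorm u ^+ 2 = dot u u.
Proof. by rewrite sqr_sqrtr // dot_ge0. Qed.

Lemma enormN u : enorm (- u) = enorm u.
Proof. by rewrite /enorm !dotE opprK. Qed.

Lemma enormBC u v : enorm (u - v) = enorm (v - u).
Proof. by rewrite -enormN opprB. Qed.

Lemma enormZ a u : enorm (a *: u) = `|a| * enorm u.
Proof.
by rewrite /enorm !dotE mulrA -expr2 sqrtrM ?sqr_ge0// sqrtr_sqr.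
Qed.

Lemma enorm_le_sqr u a : 0 <= a -> dot u u <= a ^+ 2 -> enorm u <= a.
Proof.
by move=> a0 ua; rewrite -(ler_pXn2r (ltn0Sn 1)) ?nnegrE ?enorm_ge0// enorm_sqr.
Qed.

Lemma dot_le_enorm u v : dot u v <= enorm u * enorm v.
Proof.
have [uv0|uv0] := leP (dot u v) 0.
  by rewrite (le_trans uv0)// mulr_ge0 ?enorm_ge0.
rewrite -(ler_pXn2r (ltn0Sn 1)) ?nnegrE ?mulr_ge0 ?enorm_ge0 ?(ltW uv0)//.
rewrite exprMn !enorm_sqr.
have [v0|v0] := eqVneq (dot v v) 0.
  (* a combination with a large weight on [v] would have a negative square norm *)
  have := dot_ge0 (dot u v *: u - (dot u u + 1) *: v).
  rewrite !dotE (dotC v u) v0.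
  have := dot_ge0 u; nra.
have vv : 0 < dot v v by rewrite lt_neqAle eq_sym v0 dot_ge0.
have := dot_ge0 (dot v v *: u - dot u v *: v).
rewrite !dotE (dotC v u) => h.
have : 0 <= dot v v * (dot u u * dot v v - dot u v ^+ 2) by nra.
by rewrite pmulr_rge0// subr_ge0.
Qed.

Lemma enormD u v : enorm (u + v) <= enorm u + enorm v.
Proof.
apply: enorm_le_sqr; first by rewrite addr_ge0 ?enorm_ge0.
rewrite !dotE (dotC v u) sqrrD !enorm_sqr; have := dot_le_enorm u v; lra.
Qed.

Lemma enorm_conv s u v a : 0 <= s <= 1 -> enorm u <= a -> enorm v <= a ->
  enorm ((1 - s) *: u + s *: v) <= a.
Proof.
move=> /andP[s0 s1] ua va; apply: le_trans (enormD _ _) _.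
rewrite !enormZ !ger0_norm ?subr_ge0//; nra.
Qed.

Lemma coord_le_enorm u i : `|u 0 i| <= enorm u.
Proof.
rewrite -sqrtr_sqr /enorm ler_sqrt ?dot_ge0// /dot (bigD1 i)//= expr2 lerDl.
by apply: sumr_ge0 => j _; rewrite -expr2 sqr_ge0.
Qed.

Lemma mx_norm_le_enorm u : `|u| <= enorm u.
Proof.
rewrite /Num.norm/= mx_normrE; apply: bigmax_le; first exact: enorm_ge0.
by move=> [i j] _ /=; rewrite ord1 coord_le_enorm.
Qed.

Lemma dot_continuous u : continuous (dot u).
Proof.
move=> x; rewrite /dot.
have -> : (fun v : 'rV[R]_n => \sum_(i < n) u 0 i * v 0 i) =
          \sum_(i < n) (fun v : 'rV[R]_n => u 0 i * v 0 i).
  by apply/funext => v; rewrite fct_sumE.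
elim/big_ind : _ => [|h1 h2 c1 c2|i _].
- exact: (@cst_continuous _ _ (0 : R)).
- exact: continuousD.
- by apply: continuousM; [exact: cst_continuous | exact: coord_continuous].
Qed.

Lemma dot_self_continuous c : continuous (fun v : 'rV[R]_n => dot (v - c) (v - c)).
Proof.
move=> x; rewrite /dot.
have -> : (fun v : 'rV[R]_n => \sum_(i < n) (v - c) 0 i * (v - c) 0 i) =
          \sum_(i < n) (fun v : 'rV[R]_n => (v 0 i - c 0 i) * (v 0 i - c 0 i)).
  by apply/funext => v; rewrite fct_sumE; apply: eq_bigr => i _; rewrite !mxE.
elim/big_ind : _ => [|h1 h2 c1 c2|i _].
- exact: (@cst_continuous _ _ (0 : R)).
- exact: continuousD.
- have ci : {for x, continuous (fun v : 'rV[R]_n => v 0 i - c 0 i)}.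
    by apply: continuousB; [exact: coord_continuous | exact: cst_continuous].
  exact: (continuousM ci ci).
Qed.

End Euclidean.

(** * Existence of proximal points *)

Section Existence.
Context {R : realType} {n : nat}.
Implicit Types (u v w z : 'rV[R]_n) (a s : R).

(** The quadratic lower bound confines the sublevel set to a ball, and lower
    semicontinuity makes it closed. *)
Lemma compact_sublevel (phi : 'rV[R]_n -> \bar R) (b k : R) c r :
  lower_semicontinuous phi -> 0 < k ->
  (forall w, ((b + k * enorm (w - c) ^+ 2)%:E <= phi w)%E) ->
  compact [set w | (phi w <= r%:E)%E].
Proof.
move=> lsc k0 lb; apply: bounded_closed_compact; last first.
  have -> : [set w | (phi w <= r%:E)%E] = ~` [set w | (r%:E < phi w)%E].
    by apply/seteqP; split=> w /=; rewrite leNgt => /negP.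
  by apply: open_closedC; exact: (lower_semicontinuousP phi).1.
exists (enorm c + (1 + (r - b) / k)); split; first exact: num_real.
move=> M rM w /= wr; apply: le_trans (ltW rM).
apply: le_trans (mx_norm_le_enorm w) _.
rewrite -[w in leLHS](subrK c) addrC (le_trans (enormD _ _))// lerD2l.
have : b + k * enorm (w - c) ^+ 2 <= r.
  by rewrite -lee_fin; apply: le_trans (lb w) wr.
rewrite addrC -lerBrDr mulrC -ler_pdivlMr// => h.
have := enorm_ge0 (w - c).
set e := enorm _ in h *; set q := _ / k in h *; nra.
Qed.

(** The sublevel sets at the heights above the infimum [m] form a filter that
    lives in a compact set. At a cluster point the value cannot exceed [m], since
    lower semicontinuity would keep it above some [m + e] on a neighbourhood. *)
Lemma coercive_argmin (phi : 'rV[R]_n -> \bar R) (b k : R) c :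
  lower_semicontinuous phi -> 0 < k ->
  (forall w, ((b + k * enorm (w - c) ^+ 2)%:E <= phi w)%E) ->
  (exists w, phi w < +oo)%E ->
  exists z, is_argmin phi z.
Proof.
move=> lsc k0 lb [w0 w0oo].
have lb' w : (b%:E <= phi w)%E.
  by apply: le_trans (lb w); rewrite lee_fin lerDl mulr_ge0 ?(ltW k0)// sqr_ge0.
pose A := [set r | exists w, (phi w <= r%:E)%E].
have Ab r : A r -> b <= r.
  by move=> [w wr]; rewrite -lee_fin (le_trans (lb' w)).
have iA : has_inf A.
  split; last by exists b => r /Ab.
  exists (fine (phi w0)), w0; rewrite fineK// fin_numElt w0oo.
  by rewrite (lt_le_trans _ (lb' w0))// ltNyr.
pose m := inf A.
pose G := filter_from [set e : R | 0 < e]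
  (fun e => [set w | (phi w <= (m + e)%:E)%E]).
have PG : ProperFilter G.
  apply: filter_from_proper; last first.
    move=> e /= e0; have [r [w wr] rm] := inf_adherent e0 iA.
    by exists w => /=; rewrite (le_trans wr)// lee_fin ltW.
  apply: filter_from_filter; first by exists 1 => /=.
  move=> e1 e2 /= e10 e20; exists (Num.min e1 e2); first by rewrite /= lt_min e10.
  move=> w /= h; split; apply: (le_trans h); rewrite lee_fin lerD2l.
    by rewrite ge_min lexx.
  by rewrite ge_min lexx orbT.
have GK : G [set w | (phi w <= (m + 1)%:E)%E] by exists 1 => /=.
have [z [_ clz]] := compact_sublevel lsc k0 lb PG GK.
have zm : (phi z <= m%:E)%E.
  rewrite leNgt; apply/negP => mz.
  have [e e0 ez] : exists2 e, 0 < e & ((m + e)%:E < phi z)%E.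
    case: (phi z) mz => [r| |//]; last by exists 1; rewrite ?ltry.
    rewrite lte_fin => mr; exists ((r - m) / 2); first by lra.
    by rewrite lte_fin; lra.
  have [V Vz hV] := lsc _ _ ez.
  have Ge : G [set w | (phi w <= (m + e)%:E)%E] by exists e.
  have [w [/= w1 w2]] := clz _ _ Ge Vz.
  by have := hV _ w2; rewrite ltNge w1.
exists z => w; apply: (le_trans zm).
have := lb' w; case E : (phi w) => [r| |//]; last by move=> _; rewrite leey.
by move=> _; rewrite lee_fin; apply: ge_inf; [exact: iA.2 | exists w; rewrite E].
Qed.

(** The objectives of the two proximal subproblems are both of this form, with
    [a = alpha] in an iteration and [a = 1] in the residual procedure. *)
Definition prox_objective (P : 'rV[R]_n -> \bar R) (gamma a : R) g c w : \bar R :=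
  (gamma%:E * P w + (gamma * dot g w + a / 2 * enorm (w - c) ^+ 2)%:E)%E.

Lemma lsc_prox_objective P gamma a g c : 0 < gamma ->
  (forall w, P w <> -oo%E) -> lower_semicontinuous P ->
  lower_semicontinuous (prox_objective P gamma a g c).
Proof.
move=> g0 PNy lscP x b.
pose psi w := gamma * dot g w + a / 2 * dot (w - c) (w - c).
have cpsi : {for x, continuous psi}.
  apply: continuousD.
    by apply: continuousM; [exact: cst_continuous | exact: dot_continuous].
  by apply: continuousM; [exact: cst_continuous | exact: dot_self_continuous].
rewrite /prox_objective => bx.
(* a level [r] below [P x] that leaves room for the continuous part *)
have [r rx br] : exists2 r, (r%:E < P x)%E & b < gamma * r + psi x.
  move: bx; rewrite enorm_sqr -/(psi x).
  case: (P x) (PNy x) => [p| |//] _.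
    rewrite -EFinM -EFinD lte_fin => h.
    exists (p - (gamma * p + psi x - b) / (2 * gamma)).
      by rewrite lte_fin ltrBlDr ltrDl divr_gt0// ?mulr_gt0//; lra.
    rewrite -subr_gt0.
    have -> : gamma * (p - (gamma * p + psi x - b) / (2 * gamma)) + psi x - b =
      (gamma * p + psi x - b) / 2 by field; rewrite gt_eqF.
    by rewrite divr_gt0//; lra.
  move=> _; exists ((b - psi x + 1) / gamma); first by rewrite ltry.
  rewrite mulrC divfK ?gt_eqF//; lra.
have [V Vx hV] := lscP _ _ rx.
exists (V `&` [set w | b - gamma * r < psi w]).
  apply: filterI => //; apply: (cpsi [set y | b - gamma * r < y]).
  by apply: lt_nbhsr; lra.
move=> w /= [Vw]; rewrite enorm_sqr -/(psi w) => hw.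
have := hV _ Vw; case: (P w) (PNy w) => [p| |//] _.
  rewrite lte_fin -EFinM -EFinD lte_fin; nra.
by move=> _; rewrite gt0_muley ?lte_fin// addye// ltry.
Qed.

(** An affine minorant of [P] makes the proximal objective coercive, because the
    quadratic term dominates every affine function. *)
Lemma prox_exists P gamma a b h g c : 0 < gamma -> 0 < a ->
  Defs.proper P -> lower_semicontinuous P ->
  (forall w, ((b + dot h w)%:E <= P w)%E) ->
  exists z, is_argmin (prox_objective P gamma a g c) z.
Proof.
move=> g0 a0 [PNy [x0 x0D]] lscP Pb.
pose u := gamma *: (g + h).
apply: (@coercive_argmin _ (gamma * b + dot u c - dot u u / a) (a / 4) c).
- exact: lsc_prox_objective.
- by rewrite divr_gt0.
- move=> w; rewrite /prox_objective.
  have hP : (gamma%:E * (b + dot h w)%:E <= gamma%:E * P w)%E.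
    by rewrite lee_pmul2l ?lte_fin.
  apply: le_trans (leeD2r _ hP).
  rewrite -EFinM -EFinD lee_fin enorm_sqr.
  (* half of the quadratic term is given up to complete the square *)
  have : 0 <= a^-1 * dot ((a / 2) *: (w - c) + u) ((a / 2) *: (w - c) + u).
    by rewrite mulr_ge0 ?dot_ge0// invr_ge0 ltW.
  rewrite -(subrK c w); move: (w - c) => d; rewrite addrK.
  rewrite /u !dotE (dotC d g) (dotC d h) (dotC h g).
  rewrite -subr_ge0 => /le_trans; apply; rewrite le_eqVlt; apply/orP; left.
  by apply/eqP; field; rewrite gt_eqF.
- exists x0; rewrite /prox_objective; move: x0D; rewrite /dom /=.
  by case: (P x0) (PNy x0) => [p| |//] _ // _; rewrite -EFinM -EFinD ltry.
Qed.

End Existence.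

(** * Convex functions and proximal steps *)

Section ConvexFunctions.
Context {R : realType} {n : nat}.
Implicit Types (u v w z : 'rV[R]_n) (a s : R).

Lemma ler_limit (s0 a b c : R) : 0 < s0 ->
  (forall s, 0 < s <= s0 -> a <= b + s * c) -> a <= b.
Proof.
move=> s00 h; apply/ler_addgt0Pr => e e0.
have d0 : 0 < `|c| + 1 by rewrite ltr_wpDl.
pose s := Num.min s0 (e / (`|c| + 1)).
have s_gt0 : 0 < s by rewrite lt_min s00 divr_gt0.
apply: le_trans (h s _) _; first by rewrite s_gt0 ge_min lexx.
rewrite lerD2l; apply: (@le_trans _ _ (s * (`|c| + 1))).
  by rewrite ler_wpM2l ?(ltW s_gt0)// (le_trans (ler_norm c))// lerDl.
by rewrite -ler_pdivlMr// /s ge_min lexx orbT.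
Qed.

(** Summing the gradient inequalities over a subdivision of the segment into
    [N + 1] equal pieces gives the bound with [L / 2 * (1 + 1 / (N + 1))] in place of
    [L / 2]; no integration along the segment is needed. *)
Lemma descent (phi : 'rV[R]_n -> R) (g : 'rV[R]_n -> 'rV[R]_n)
    (A : set 'rV[R]_n) L x y :
  0 <= L ->
  (forall s, 0 <= s <= 1 -> A ((1 - s) *: y + s *: x)) ->
  (forall u v, A u -> A v -> phi v + dot (g v) (u - v) <= phi u) ->
  lipschitz_const L A g ->
  phi x <= phi y + dot (g y) (x - y) + L / 2 * dot (x - y) (x - y).
Proof.
move=> L0 seg conv lip.
set d := x - y.
have bound N : phi x <= phi y + dot (g y) d + L / 2 * dot d d
    + N.+1%:R^-1 * (L / 2 * dot d d).
  have N0 : (0 : R) < N.+1%:R by rewrite ltr0Sn.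
  pose h : R := N.+1%:R^-1.
  have h0 : 0 < h by rewrite invr_gt0.
  have hN : h * N.+1%:R = 1 by rewrite mulVf ?gt_eqF.
  have hN' : N.+1%:R * h = 1 by rewrite mulrC.
  (* the subdivision points, from [u 0 = y] to [u N.+1 = x] *)
  pose u (i : nat) := y + (i%:R * h) *: d.
  have uA i : (i <= N.+1)%N -> A (u i).
    move=> iN; have -> : u i = (1 - i%:R * h) *: y + (i%:R * h) *: x.
      by rewrite /u /d scalerBr scalerBl scale1r -addrA [- _ + _]addrC.
    apply: seg; rewrite mulr_ge0 ?ler0n ?(ltW h0)//=.
    by rewrite mulrC -[leRHS]hN ler_pM2l// ler_nat.
  have y0 : u 0 = y by rewrite /u mul0r scale0r addr0.
  suff /(_ N.+1 (leqnn _)) : forall i, (i <= N.+1)%N ->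
      phi (u i) <= phi y + (i%:R * h) * dot (g y) d
        + L / 2 * dot d d * (i%:R * (i%:R + 1) * h ^+ 2).
    have -> : u N.+1 = x by rewrite /u hN' scale1r /d addrC subrK.
    rewrite hN'.
    have -> : N.+1%:R * (N.+1%:R + 1) * h ^+ 2 =
      (h * N.+1%:R) * (h * N.+1%:R) + h * (h * N.+1%:R) by ring.
    rewrite hN => /le_trans; apply; rewrite le_eqVlt; apply/orP; left.
    by apply/eqP; rewrite /h; ring.
  elim=> [_|i IH iN]; first by rewrite y0; lra.
  have := conv _ _ (uA i (ltnW iN)) (uA _ iN).
  have -> : u i - u i.+1 = - (h *: d).
    rewrite /u opprD addrACA subrr add0r -scalerBl -[RHS]scaleNr; congr (_ *: _).
    by rewrite -natr1; ring.
  have lipi : dot (g (u i.+1)) d <= dot (g y) d + L * (i.+1%:R * h) * dot d d.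
    rewrite -lerBlDl.
    have -> : dot (g (u i.+1)) d - dot (g y) d = dot (g (u i.+1) - g y) d.
      by rewrite !dotE.
    apply: le_trans (dot_le_enorm _ _) _.
    have := lip _ _ (uA _ iN) (uA 0%N (leq0n _)); rewrite y0.
    have -> : u i.+1 - y = (i.+1%:R * h) *: d by rewrite /u addrC addKr.
    rewrite enormZ ger0_norm; last by rewrite mulr_ge0 ?ler0n// ltW.
    rewrite -enorm_sqr; have := enorm_ge0 d; nra.
  have {}lipi : h * dot (g (u i.+1)) d <=
     h * (dot (g y) d + L * (i.+1%:R * h) * dot d d) by rewrite ler_pM2l.
  have := IH (ltnW iN); rewrite dotNr dotZr -natr1 in lipi * => IHi hc.
  lra.
apply: (@ler_limit 1 _ _ (L / 2 * dot d d)) => // s /andP[s0 s1].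
have [N hN] := ltr_add_invr s0; rewrite add0r in hN.
apply: le_trans (bound N) _; rewrite lerD2l ler_wpM2r ?(ltW hN)//.
by rewrite mulr_ge0 ?dot_ge0// divr_ge0.
Qed.

Section Proximal.
Variable P : 'rV[R]_n -> \bar R.
Hypothesis Pproper : Defs.proper P.
Hypothesis Pconvex : Defs.convex P.
Notation p := (fine \o P).

Lemma dom_fine x : dom P x -> P x = (p x)%:E.
Proof.
by move=> xD; rewrite /= fineK// fin_numElt xD ltNye; apply/andP; split => //;
  apply/eqP; exact: Pproper.1.
Qed.

Lemma dom_convex s x y : 0 <= s <= 1 -> dom P x -> dom P y ->
  dom P ((1 - s) *: x + s *: y) /\
  p ((1 - s) *: x + s *: y) <= (1 - s) * p x + s * p y.
Proof.
move=> s01 xD yD; have s01' : 0 <= 1 - s <= 1 by lra.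
have := Pconvex x y s01'.
rewrite (_ : 1 - (1 - s) = s); last by ring.
rewrite (dom_fine xD) (dom_fine yD) -!EFinM -EFinD => h.
have zD : dom P ((1 - s) *: x + s *: y) by rewrite /dom /= (le_lt_trans h)// ltry.
by split => //; move: h; rewrite (dom_fine zD) lee_fin.
Qed.

(** The objective minimized in a proximal step is [a]-strongly convex, so it
    grows at least like [a / 2 * |w - z| ^ 2] away from its minimizer [z]. *)
Lemma prox_growth gamma a g c z : 0 < gamma -> 0 < a ->
  is_argmin (prox_objective P gamma a g c) z ->
  dom P z /\ forall w, dom P w ->
    gamma * (dot g z + p z) + a / 2 * dot (z - c) (z - c)
      + a / 2 * dot (w - z) (w - z)
    <= gamma * (dot g w + p w) + a / 2 * dot (w - c) (w - c).
Proof.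
move=> gam0 a0 zmin.
have zD : dom P z.
  have [x0 x0D] := Pproper.2; have := zmin x0.
  rewrite /prox_objective (dom_fine x0D) -EFinM -EFinD /dom /=.
  case: (P z) (Pproper.1 z) => [r _ _| _|//]; first exact: ltry.
  by rewrite gt0_muley ?lte_fin// addye// leye_eq.
split=> // w wD.
apply: (@ler_limit 1 _ _ (a / 2 * dot (w - z) (w - z))) => // s /andP[s0 s1].
have s01 : 0 <= s <= 1 by rewrite ltW.
have [wsD ps] := dom_convex s01 zD wD.
have := zmin ((1 - s) *: z + s *: w).
rewrite /prox_objective (dom_fine wsD) (dom_fine zD) -!EFinM -!EFinD lee_fin.
rewrite !enorm_sqr.
have -> : dot ((1 - s) *: z + s *: w - c) ((1 - s) *: z + s *: w - c) =
   (1 - s) * dot (z - c) (z - c) + s * dot (w - c) (w - c)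
   - s * (1 - s) * dot (w - z) (w - z).
  by rewrite !dotE (dotC w z) (dotC c z) (dotC c w); ring.
have -> : dot g ((1 - s) *: z + s *: w) = (1 - s) * dot g z + s * dot g w.
  by rewrite dotDr !dotZr.
move=> h.
have {}ps := ler_wpM2l (ltW gam0) ps.
rewrite -(ler_pM2l s0); move: h ps; lra.
Qed.

(** The part of [prox_growth] that is linear in [w - z] is the optimality
    condition, because [|w - c| ^ 2 - |w - z| ^ 2 - |z - c| ^ 2] is linear. *)
Lemma prox_subgradient gamma g c z : 0 < gamma ->
  is_argmin (prox_objective P gamma 1 g c) z ->
  forall w, dom P w -> p z + dot (gamma^-1 *: (c - z) - g) (w - z) <= p w.
Proof.
move=> gam0 zmin w wD; have [zD /(_ w wD) h] := prox_growth gam0 ltr01 zmin.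
rewrite -(ler_pM2l gam0) -subr_ge0; move: h; rewrite -subr_ge0.
move=> /le_trans; apply; rewrite le_eqVlt; apply/orP; left; apply/eqP.
rewrite !dotE (dotC z w) (dotC c w) (dotC c z); field; rewrite gt_eqF//.
Qed.

(** Nonexpansiveness of the proximal map, with [xs] as the second proximal point:
    when [- gs] is a subgradient of [P] at [xs], the point [xs] minimizes the
    proximal objective with linear part [gs] and centre [xs]. *)
Lemma prox_nonexpansive gamma a g c z xs gs : 0 < gamma -> 0 < a ->
  is_argmin (prox_objective P gamma a g c) z -> dom P xs ->
  (forall w, dom P w -> p xs - dot gs (w - xs) <= p w) ->
  a * enorm (z - xs) <= a * enorm (c - xs) + gamma * enorm (g - gs).
Proof.
move=> gam0 a0 zmin xsD xsP.
have [zD /(_ xs xsD) h] := prox_growth gam0 a0 zmin.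
have h' := ler_wpM2l (ltW gam0) (xsP z zD).
have [e0|e0] := eqVneq (enorm (z - xs)) 0.
  by rewrite e0 mulr0 addr_ge0// mulr_ge0 ?enorm_ge0// ltW.
have e_gt0 : 0 < enorm (z - xs) by rewrite lt_neqAle eq_sym e0 enorm_ge0.
rewrite -(ler_pM2r e_gt0).
have key : a * dot (z - xs) (z - xs) <=
    a * dot (c - xs) (z - xs) + gamma * dot (- (g - gs)) (z - xs).
  move: h h'; rewrite !dotE (dotC z xs) (dotC c xs) (dotC c z); lra.
have := dot_le_enorm (c - xs) (z - xs).
have := dot_le_enorm (- (g - gs)) (z - xs); rewrite enormN.
move: key; rewrite -enorm_sqr; nra.
Qed.

End Proximal.
End ConvexFunctions.

(** * The parameters of an iteration *)

Section StepParameter.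
Context {R : realType}.
Implicit Types a g alpha gamma mu : R.

(** In [alpha] the equation is quadratic, negative at [0] and, because
    [mu * gamma <= 1], nonnegative at [1]; the witness is its positive root. *)
Lemma alpha_exists a g gamma mu : 0 < a -> 0 < g -> 0 < gamma ->
  0 < mu -> mu * gamma <= 1 ->
  exists alpha, 0 < alpha <= 1 /\
    g * alpha ^+ 2 = (1 - alpha) * a ^+ 2 * gamma + mu * alpha * gamma * g.
Proof.
move=> a0 g0 gam0 mu0 mg1.
pose c := a ^+ 2 * gamma; pose b := c - mu * gamma * g.
have c0 : 0 < c by rewrite mulr_gt0// exprn_gt0.
pose d := b ^+ 2 + 4 * g * c.
have gc0 : 0 < g * c by rewrite mulr_gt0.
have d0 : 0 <= d by rewrite /d; have := sqr_ge0 b; lra.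
have sd := sqr_sqrtr d0; have sd0 := sqrtr_ge0 d.
have mgg : mu * gamma * g <= g by rewrite ler_piMl// ltW.
exists ((Num.sqrt d - b) / (2 * g)); split.
  rewrite divr_gt0 ?mulr_gt0//; last first.
    rewrite subr_gt0; have [b0|b0] := ltP b 0; first exact: lt_le_trans sd0.
    rewrite -(ltr_pXn2r (ltn0Sn 1)) ?nnegrE// sd /d; lra.
  rewrite ler_pdivrMr ?mulr_gt0// mul1r lerBlDr.
  rewrite -(ler_pXn2r (ltn0Sn 1)) ?nnegrE//; last by rewrite /b; lra.
  rewrite sd /d -subr_ge0.
  have -> : (2 * g + b) ^+ 2 - (b ^+ 2 + 4 * g * c) = 4 * g * (g - mu * gamma * g).
    by rewrite /b; ring.
  by rewrite mulr_ge0 ?subr_ge0// mulr_ge0// ltW.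
rewrite -mulrA (mulrC _ gamma) -/c; set s := Num.sqrt d in sd sd0 *.
have g2 : g != 0 by rewrite gt_eqF.
apply/eqP; rewrite -subr_eq0.
have -> : g * ((s - b) / (2 * g)) ^+ 2 - ((1 - (s - b) / (2 * g)) * (gamma * a ^+ 2)
   + mu * ((s - b) / (2 * g)) * gamma * g) = (s ^+ 2 - d) / (4 * g).
  by rewrite /d /b /c; field.
by rewrite sd subrr mul0r.
Qed.

(** Both bounds come from the nonnegativity of [(1 - alpha) * a ^+ 2 * gamma]. The
    first one gives [beta <= 1]; the second one propagates [mu * g <= a ^+ 2]
    from an iteration to the next. *)
Lemma alpha_ge a g alpha gamma mu :
  0 < a -> 0 < g -> 0 < gamma -> 0 < mu -> 0 < alpha <= 1 ->
  g * alpha ^+ 2 = (1 - alpha) * a ^+ 2 * gamma + mu * alpha * gamma * g ->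
  mu * gamma <= alpha /\ (mu * g <= a ^+ 2 -> mu * gamma <= alpha ^+ 2).
Proof.
move=> a0 g0 gam0 mu0 /andP[al0 al1] E; split.
  have : 0 <= g * alpha * (alpha - mu * gamma).
    have -> : g * alpha * (alpha - mu * gamma) = (1 - alpha) * a ^+ 2 * gamma.
      by rewrite -[RHS](addrK (mu * alpha * gamma * g)) -E; ring.
    by rewrite !mulr_ge0 ?subr_ge0 ?sqr_ge0// ltW.
  by rewrite pmulr_rge0 ?mulr_gt0// subr_ge0.
move=> h; rewrite -(ler_pM2l g0) E.
have : 0 <= (1 - alpha) * gamma by rewrite mulr_ge0 ?subr_ge0// ltW.
nra.
Qed.

End StepParameter.

Section Extrapolation.
Context {R : realType} {n : nat}.
Implicit Types (x y z : 'rV[R]_n).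

(** The fixed-point form of [y] gives [x' - y = alpha *: (z' - c)] for the centre
    [c] of the proximal step. It holds also when [alpha = beta = 1], where it does
    not determine [y]. *)
Lemma extrapolationP (alpha beta : R) x z y :
  0 < alpha <= 1 -> 0 <= beta <= 1 -> extrapolation alpha beta x z y ->
  (exists2 s : R, 0 <= s <= 1 & y = (1 - s) *: x + s *: z) /\
  y = (1 - alpha) *: x + alpha *: (beta *: y + (1 - beta) *: z).
Proof.
move=> /andP[al0 al1] /andP[be0 be1]; rewrite /extrapolation.
case: eqP => [ab1|/eqP ab1].
  move=> yE; split => //.
  have a1 : alpha = 1 by nra.
  have b1 : beta = 1 by move: ab1; rewrite a1 mul1r.
  by rewrite a1 b1 !subrr !scale0r addr0 add0r !scale1r.
have ab : alpha * beta < 1 by rewrite lt_neqAle ab1; nra.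
have dn0 : 1 - alpha * beta != 0 by rewrite gt_eqF// subr_gt0.
move=> yE; have yE' : (1 - alpha * beta) *: y =
    (1 - alpha) *: x + (alpha * (1 - beta)) *: z.
  by rewrite yE scalerA mulfV// scale1r.
split; last first.
  by rewrite scalerDr !scalerA addrCA -yE' -scalerDl addrC subrK scale1r.
exists (alpha * (1 - beta) / (1 - alpha * beta)).
  rewrite divr_ge0/= ?mulr_ge0 ?subr_ge0 ?(ltW al0) ?(ltW ab)//.
  rewrite ler_pdivrMr ?subr_gt0//; nra.
have -> : 1 - alpha * (1 - beta) / (1 - alpha * beta) =
    (1 - alpha) / (1 - alpha * beta) by field.
by rewrite yE scalerDr !scalerA ![_^-1 * _]mulrC.
Qed.

End Extrapolation.

(** * The logarithmic bounds *)

Section Bounds.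
Context {R : realType}.

(** For [r0 = 0] or [q = 1] the logarithms carry no information, but then the
    left-hand side vanishes. *)
Lemma rate_term_sufficient (q eps r0 C : R) (t : nat) :
  0 < q <= 1 -> 0 < eps -> 0 <= r0 -> 0 < C -> (0 < t)%N ->
  ceilp (2 * ln (eps / (r0 * C)) / ln (1 - q)) <= t%:Z ->
  C * (r0 * Num.sqrt ((1 - q) ^+ t)) <= eps.
Proof.
move=> /andP[q0 q1] eps0; rewrite le_eqVlt => /predU1P[<-|r0_gt0] C0 t0.
  by move=> _; rewrite mul0r mulr0 ltW.
move: q1; rewrite le_eqVlt => /predU1P[->|q1].
  by move=> _; rewrite subrr expr0n gtn_eqF// sqrtr0 !mulr0 ltW.
have rC : 0 < r0 * C by rewrite mulr_gt0.
set e := eps / (r0 * C); have e0 : 0 < e by rewrite divr_gt0.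
have q10 : 0 < 1 - q by rewrite subr_gt0.
have lnq : ln (1 - q) < 0 by rewrite ln_lt0// q10/= ltrBlDr ltrDl.
rewrite /ceilp ge_max => /andP[+ _].
rewrite ceil_le_int ler_ndivrMr// => h.
suff : Num.sqrt ((1 - q) ^+ t) <= e.
  rewrite /e ler_pdivlMr//; apply: le_trans.
  by rewrite le_eqVlt; apply/orP; left; apply/eqP; ring.
rewrite -[leRHS](ger0_norm (ltW e0)) -sqrtr_sqr ler_sqrt ?sqr_ge0//.
rewrite -ler_ln ?posrE ?exprn_gt0//.
by rewrite !lnXn// -mulr_natl -[leRHS]mulr_natl.
Qed.

Lemma linesearch_exponent (gamma0 L delta : R) (k : nat) :
  0 < gamma0 -> 0 < L -> 0 < delta < 1 -> 1 < gamma0 * delta ^+ k * L ->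
  k%:Z < ceilp (ln (gamma0 * L) / ln (1 / delta)).
Proof.
move=> g0 L0 /andP[d0 d1] h; rewrite /ceilp lt_max; apply/orP; left.
have lnd : 0 < ln (1 / delta) by rewrite ln_gt0// div1r invf_gt1.
rewrite ceil_gt_int ltr_pdivlMr//.
have gL : 0 < gamma0 * L by rewrite mulr_gt0.
have : ln (gamma0 * delta ^+ k * L) = ln (gamma0 * L) + k%:R * ln delta.
  rewrite mulrAC [LHS]lnM ?posrE ?gL ?exprn_gt0//.
  by rewrite lnXn// mulr_natl.
have : 0 < ln (gamma0 * delta ^+ k * L) by rewrite ln_gt0.
rewrite div1r lnV ?posrE//; lra.
Qed.

End Bounds.

(** * One iteration of the method *)

Section Problem.
Context {R : realType} {n : nat}.
Variables (f P : 'rV[R]_n -> \bar R) (xs : 'rV[R]_n) (mu : R).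
Hypothesis fproper : forall x, f x <> -oo%E.
Hypothesis Pproper : Defs.proper P.
Hypothesis Pclosed : lower_semicontinuous P.
Hypothesis Pconvex : Defs.convex P.
Hypothesis fdiff : forall x, closure (dom P) x -> ediff f x.
Hypothesis flip : locally_lipschitz_grad f (closure (dom P)).
Hypothesis Fxs : (f xs + P xs)%E \is a fin_num.
Hypothesis xsmin : is_argmin (fun x => (f x + P x)%E) xs.
Hypothesis mu0 : 0 < mu.
Hypothesis fconv : convexity_parameter mu f (dom P).
(** An abstract name for the gradient, whose values are then atoms for the
    arithmetic procedures; otherwise they unfold the definition of the
    differential. *)
Variable G : 'rV[R]_n -> 'rV[R]_n.
Hypothesis gradE : grad f = G.
Implicit Types x y z w : 'rV[R]_n.

Notation D := (dom P).
Notation phi := (fine \o f).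
Notation p := (fine \o P).

Definition gap x := phi x + p x - (phi xs + p xs).

Lemma f_fine x : D x -> f x = (phi x)%:E.
Proof.
move=> xD; have [/nbhs_singleton h _] := fdiff (subset_closure xD).
by rewrite /= fineK.
Qed.

Lemma F_fine x : D x -> (f x + P x)%E = (phi x + p x)%:E.
Proof. by move=> xD; rewrite (f_fine xD) (dom_fine Pproper xD). Qed.

Lemma xs_dom : D xs.
Proof.
have := Fxs; rewrite /dom /=.
case: (P xs) => [r _| |]; [by rewrite ltry | | by []].
by case: (f xs).
Qed.

Lemma strong_convexity x y : D x -> D y ->
  phi x + dot (G x) (y - x) + mu / 2 * dot (x - y) (x - y) <= phi y.
Proof.
move=> xD yD; have := fconv y xD.
by rewrite (f_fine xD) (f_fine yD) gradE -EFinD lee_fin enorm_sqr addrA.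
Qed.

Lemma gradient_ineq x y : D x -> D y ->
  phi x + dot (G x) (y - x) <= phi y.
Proof.
move=> xD yD; apply: le_trans (strong_convexity xD yD).
by rewrite lerDl mulr_ge0 ?dot_ge0// divr_ge0// ltW.
Qed.

Lemma gap_ge0 x : D x -> 0 <= gap x.
Proof.
move=> xD; have := xsmin x.
by rewrite (F_fine xD) (F_fine xs_dom) lee_fin /gap subr_ge0.
Qed.

(** Optimality of [xs]: at the point [y s = xs + s (w - xs)] the minimality of [xs]
    and the gradient inequality give the claim with [G (y s)] in place of [G xs],
    and [G] is continuous at [xs]. *)
Lemma xs_subgradient w : D w -> p xs - dot (G xs) (w - xs) <= p w.
Proof.
move=> wD; have [L [U [L0 oU Uxs _ lipU]]] := flip (subset_closure xs_dom).
rewrite gradE in lipU.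
pose y (s : R) := (1 - s) *: xs + s *: w.
have yE s : y s - xs = s *: (w - xs).
  by rewrite /y scalerBl scale1r scalerBr addrC !addrA addNr add0r addrC.
have [s0 s00 Us] : exists2 s0 : R, 0 < s0 & forall s, 0 < s <= s0 -> U (y s).
  have cy : {for (0 : R), continuous y}.
    apply: continuousD; apply: continuousZr_tmp => //.
    by apply: continuousB; [exact: cst_continuous|].
  have : nbhs (y 0) U by rewrite /y subr0 scale1r scale0r addr0; exact: open_nbhs_nbhs.
  move=> /cy /nbhs_ballP[e /= e0 eU].
  exists (e / 2); first by rewrite divr_gt0.
  move=> s /andP[s0 se]; apply: eU; rewrite /ball /= sub0r normrN gtr0_norm//.
  by rewrite (le_lt_trans se)// ltr_pdivrMr// ltr_pMr// ltr1n.
have m0 : 0 < Num.min s0 1 by rewrite lt_min s00 /=.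
apply: (@ler_limit _ (Num.min s0 1) _ _ (L * dot (w - xs) (w - xs))) => // s.
rewrite le_min => /and3P[s_gt0 ss0 s1].
have s01 : 0 <= s <= 1 by rewrite ltW.
have [yD py] := dom_convex Pproper Pconvex s01 xs_dom wD.
rewrite -/(y s) in yD py.
have h1 := gap_ge0 yD; rewrite /gap in h1.
have h2 := gradient_ineq yD xs_dom.
have : dot (G (y s)) (w - xs) <=
    dot (G xs) (w - xs) + s * (L * dot (w - xs) (w - xs)).
  rewrite -lerBlDl.
  have -> : dot (G (y s)) (w - xs) - dot (G xs) (w - xs) =
     dot (G (y s) - G xs) (w - xs) by rewrite dotDl dotNl.
  apply: le_trans (dot_le_enorm _ _) _.
  have := lipU _ _ (Us s _) Uxs; rewrite s_gt0 ss0 yE enormZ gtr0_norm// => /(_ isT).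
  rewrite -enorm_sqr; have := enorm_ge0 (w - xs); nra.
have h3 : dot (G (y s)) (xs - y s) = - (s * dot (G (y s)) (w - xs)).
  by rewrite -opprB yE dotNr dotZr.
rewrite h3 in h2.
move=> h4; rewrite -(ler_pM2l s_gt0).
have := ler_wpM2l (ltW s_gt0) h4; lra.
Qed.

(** The coercivity of the proximal objectives is read off from the subgradient at
    [xs]. *)
Lemma P_affine_minorant w :
  ((p xs + dot (G xs) xs + dot (- G xs) w)%:E <= P w)%E.
Proof.
have [wD|wD] := pselect (D w).
  rewrite (dom_fine Pproper wD) lee_fin; apply: le_trans (xs_subgradient wD).
  by rewrite !dotE; lra.
move: wD; rewrite /dom /=; case: (P w) (Pproper.1 w) => [r| |//] _.
  by rewrite ltry.
by rewrite leey.
Qed.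

Lemma accepted_fine gamma y x : D y -> D x ->
  accepted f gamma y x <->
  2 * gamma * (phi x - phi y - dot (G y) (x - y)) <= dot (x - y) (x - y).
Proof.
move=> yD xD; rewrite /accepted gradE (f_fine yD) (f_fine xD) -!EFinB -EFinM.
by rewrite lee_fin enorm_sqr.
Qed.

Lemma accepted_of_small gamma L A y x : 0 < gamma -> 0 < L -> gamma * L <= 1 ->
  A `<=` D -> (forall s, 0 <= s <= 1 -> A ((1 - s) *: y + s *: x)) ->
  lipschitz_const L A G -> accepted f gamma y x.
Proof.
move=> g0 L0 gL AD seg lip.
have yD : D y.
  by apply: AD; have := seg 0; rewrite subr0 scale1r scale0r addr0 lexx ler01; exact.
have xD : D x.
  by apply: AD; have := seg 1; rewrite subrr scale1r scale0r add0r lexx ler01; exact.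
apply/(accepted_fine _ yD xD).
have := descent (ltW L0) seg (fun u v Au Av => gradient_ineq (AD v Av) (AD u Au)) lip.
move=> h; have := dot_ge0 (x - y); nra.
Qed.

(** The estimate-sequence inequality: one accepted iteration shrinks the
    potential by the factor [1 - alpha]. The conclusion, multiplied by [gamma],
    is a linear combination of the line search test, the convexity of [P] at
    [x'], the growth of the proximal objective at [xs], the gradient inequality at
    [x], the strong convexity inequality at [xs] and the convexity of the squared
    distance to [xs]. *)
Lemma potential_step a g alpha gamma beta x z y z' x' :
  0 < gamma -> 0 < g -> 0 < alpha <= 1 -> 0 <= beta <= 1 ->
  alpha * beta = mu * gamma ->
  g * alpha ^+ 2 = (1 - alpha) * a ^+ 2 * gamma + mu * alpha * gamma * g ->
  D x -> D y ->
  y = (1 - alpha) *: x + alpha *: (beta *: y + (1 - beta) *: z) ->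
  is_argmin (prox_objective P gamma alpha (G y)
    (beta *: y + (1 - beta) *: z)) z' ->
  x' = (1 - alpha) *: x + alpha *: z' ->
  accepted f gamma y x' ->
  gap x' + alpha ^+ 2 / gamma / 2 * dot (z' - xs) (z' - xs) <=
  (1 - alpha) * (gap x + a ^+ 2 / g / 2 * dot (z - xs) (z - xs)).
Proof.
move=> gam0 g0 al01 /andP[be0 be1] ab E xD yD yE zmin x'E acc.
have /andP[al0 al1] := al01.
have al01' : 0 <= alpha <= 1 by rewrite ltW.
set c := beta *: y + (1 - beta) *: z in yE zmin.
have [z'D /(_ xs xs_dom) prox] := prox_growth Pproper Pconvex gam0 al0 zmin.
have [x'D px'] := dom_convex Pproper Pconvex al01' xD z'D.
rewrite -x'E in x'D px'.
have d1 : x' - y = alpha *: (z' - c).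
  by rewrite x'E {1}yE scalerBr opprD addrACA subrr add0r.
have {acc} := (accepted_fine gamma yD x'D).1 acc.
have -> : dot (G y) (x' - y) =
    (1 - alpha) * dot (G y) (x - y) + alpha * dot (G y) (z' - y).
  by rewrite x'E !dotE; ring.
rewrite d1 dotZl dotZr => acc.
have sx := gradient_ineq yD xD.
have sxs := strong_convexity yD xs_dom.
have dc : dot (xs - c) (xs - c) <=
    beta * dot (y - xs) (y - xs) + (1 - beta) * dot (z - xs) (z - xs).
  rewrite -subr_ge0.
  have -> : beta * dot (y - xs) (y - xs) + (1 - beta) * dot (z - xs) (z - xs)
     - dot (xs - c) (xs - c) = beta * (1 - beta) * dot (y - z) (y - z).
    by rewrite /c !dotE (dotC z y) (dotC xs y) (dotC xs z); ring.
  by rewrite !mulr_ge0 ?dot_ge0// subr_ge0.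
have proxZ : dot (G y) z' = dot (G y) (z' - y) + dot (G y) y.
  by rewrite !dotE subrK.
have proxS : dot (G y) xs = dot (G y) (xs - y) + dot (G y) y.
  by rewrite !dotE subrK.
rewrite proxZ proxS in prox.
have zx : dot (xs - z') (xs - z') = dot (z' - xs) (z' - xs).
  by rewrite -[xs - z']opprB dotNl dotNr opprK.
rewrite zx in prox.
(* the equation of [alpha], solved for the coefficient of the old potential *)
have Ecoef : (1 - alpha) * (a ^+ 2 / g) * gamma = alpha ^+ 2 - mu * alpha * gamma.
  have -> : (1 - alpha) * (a ^+ 2 / g) * gamma =
     ((1 - alpha) * a ^+ 2 * gamma + mu * alpha * gamma * g) / g - mu * alpha * gamma.
    by field; rewrite gt_eqF.
  by rewrite -E mulrAC mulfV ?gt_eqF// mul1r.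
rewrite -(ler_pM2l gam0).
have -> : gamma * ((1 - alpha) * (gap x + a ^+ 2 / g / 2 * dot (z - xs) (z - xs))) =
  (1 - alpha) * gamma * gap x +
  (1 - alpha) * (a ^+ 2 / g) * gamma / 2 * dot (z - xs) (z - xs) by ring.
rewrite Ecoef.
have -> : gamma * (gap x' + alpha ^+ 2 / gamma / 2 * dot (z' - xs) (z' - xs)) =
   gamma * gap x' + alpha ^+ 2 / 2 * dot (z' - xs) (z' - xs).
  by field; rewrite gt_eqF.
rewrite /gap.
have {}prox := ler_wpM2l (ltW al0) prox.
have {}sx : (1 - alpha) * gamma * (phi y + dot (G y) (x - y)) <=
    (1 - alpha) * gamma * phi x.
  by rewrite ler_wpM2l// mulr_ge0 ?subr_ge0// ltW.
have ag0 : 0 <= alpha * gamma by rewrite mulr_ge0// ltW.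
have {}sxs := ler_wpM2l ag0 sxs.
have {}px' := ler_wpM2l (ltW gam0) px'.
have {}dc : alpha ^+ 2 / 2 * dot (xs - c) (xs - c) <=
    alpha * (mu * gamma) / 2 * dot (y - xs) (y - xs) +
    (alpha ^+ 2 - alpha * (mu * gamma)) / 2 * dot (z - xs) (z - xs).
  have := ler_wpM2l (divr_ge0 (sqr_ge0 alpha) (ler0n R 2)) dc.
  move=> /le_trans; apply; rewrite -ab le_eqVlt; apply/orP; left; apply/eqP; ring.
clear -acc prox sx sxs px' dc.
move: (phi x') (phi x) (phi y) (phi xs) (p x') (p x) (p z') (p xs)
  acc prox sx sxs px' dc => fx' fx fy fxs px' px pz' pxs acc prox sx sxs hp dc.
lra.
Qed.

(** * The stopping criterion *)

Section Residual.
Variables (eps : R).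

(** The vector tested by the stopping criterion is the sum of the gradient of
    [f] and the subgradient of [P] that the proximal step produces at [w]. *)
Lemma stopping_residual gamma v w : 0 < gamma ->
  is_argmin (prox_objective P gamma 1 (G v) v) w ->
  enorm (gamma^-1 *: (v - w) + G w - G v) <= eps ->
  residual_solution (fun x => (f x + P x)%E) eps w.
Proof.
move=> gam0 wmin stop.
have [wD _] := prox_growth Pproper Pconvex gam0 ltr01 wmin.
have subP := prox_subgradient Pproper Pconvex gam0 wmin.
rewrite /residual_solution /edist.
apply: le_trans (_ : (enorm (gamma^-1 *: (v - w) + G w - G v))%:E <= _)%E.
  apply: ereal_inf_lbound; exists (gamma^-1 *: (v - w) + G w - G v); last first.
    by rewrite subr0.
  move=> y /=; have [yD|yD] := pselect (D y).
    rewrite (F_fine yD) (F_fine wD) -EFinD lee_fin.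
    have := subP y yD; have := gradient_ineq wD yD.
    rewrite !(dotDl, dotNl); lra.
  have -> : P y = +oo%E.
    by move: yD; rewrite /dom /=; case: (P y) (Pproper.1 y) => [r| |//] _ //;
       rewrite ltry.
  rewrite (F_fine wD) -EFinD addey ?leey//; apply/eqP; exact: fproper.
by rewrite lee_fin.
Qed.

(** A proximal gradient step from [v] that passes the line search test decreases
    the objective by [|w - v| ^ 2 / (2 gamma)], so [|w - v|] is controlled by the
    gap at [v]. *)
Lemma residual_bound gamma L v w : 0 < gamma -> 0 <= L ->
  D v -> is_argmin (prox_objective P gamma 1 (G v) v) w ->
  accepted f gamma v w ->
  enorm (G w - G v) <= L * enorm (w - v) ->
  enorm (gamma^-1 *: (v - w) + G w - G v) <=
  (Num.sqrt (2 * gamma^-1) + Num.sqrt (2 * gamma) * L) * Num.sqrt (gap v).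
Proof.
move=> gam0 L0 vD wmin.
have [wD /(_ v vD)] := prox_growth Pproper Pconvex gam0 ltr01 wmin.
have -> : dot (v - w) (v - w) = dot (w - v) (w - v).
  by rewrite -opprB dotNl dotNr opprK.
have -> : dot (v - v) (v - v) = 0 by rewrite subrr -(scale0r v) dotZl mul0r.
move=> prox /(accepted_fine _ vD wD) acc lip.
have gw := gap_ge0 wD.
have dist : enorm (w - v) <= Num.sqrt (2 * gamma) * Num.sqrt (gap v).
  rewrite -sqrtrM ?mulr_ge0 ?(ltW gam0)// ler_sqrt; last first.
    by rewrite mulr_ge0 ?mulr_ge0 ?(ltW gam0)// gap_ge0.
  have := mulr_ge0 (ltW gam0) gw.
  move: prox acc; rewrite /gap !dotE /=; lra.
have -> : Num.sqrt (2 * gamma^-1) = gamma^-1 * Num.sqrt (2 * gamma).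
  rewrite -[gamma^-1 in RHS]ger0_norm ?invr_ge0 ?(ltW gam0)// -sqrtr_sqr.
  by rewrite -sqrtrM ?sqr_ge0//; congr Num.sqrt; field; rewrite gt_eqF.
rewrite -addrA; apply: le_trans (enormD _ _) _.
rewrite enormZ ger0_norm ?invr_ge0 ?(ltW gam0)// [enorm (v - w)]enormBC.
have gi : 0 <= gamma^-1 by rewrite invr_ge0 ltW.
have h1 := ler_wpM2l gi dist; have h2 := ler_wpM2l L0 dist; lra.
Qed.

End Residual.

(** * The trajectory *)

Section Algorithm.
Variables (eps gamma0 alpha0 delta : R) (M : nat) (x1 : 'rV[R]_n) (LS LSh : R).
Definition r0 := initial_radius (fun x => (f x + P x)%E) alpha0 gamma0 x1 xs.
Definition rho := Num.sqrt (2 * gamma0) * r0 / alpha0.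
Notation S := (dom_ball P xs rho).
Notation Sh := (dom_ball P xs ((1 + gamma0 * LS) * Num.sqrt (2 * gamma0) * r0 / alpha0)).
Notation q := (Num.sqrt (mu * Num.min gamma0 (delta * LSh^-1))).
Hypothesis eps_gt0 : 0 < eps.
Hypothesis gamma0_itv : 0 < gamma0 <= mu^-1.
Hypothesis alpha0_gt0 : 0 < alpha0.
Hypothesis alpha0_itv : Num.sqrt (mu * gamma0) <= alpha0 <= 1.
Hypothesis delta_itv : 0 < delta < 1.
Hypothesis M_gt0 : (0 < M)%N.
Hypothesis x1D : dom P x1.
Hypothesis LS_gt0 : 0 < LS.
Hypothesis LS_lip : lipschitz_const LS S G.
Hypothesis LSh_gt0 : 0 < LSh.
Hypothesis LSh_lip : lipschitz_const LSh Sh G.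

Let gamma0_gt0 : 0 < gamma0. Proof. by case/andP: gamma0_itv. Qed.
Let delta_gt0 : 0 < delta. Proof. by case/andP: delta_itv. Qed.
Let mu_gamma0 : mu * gamma0 <= 1.
Proof. by case/andP: gamma0_itv => _; rewrite -div1r ler_pdivlMr// mulrC. Qed.

Lemma r0_ge0 : 0 <= r0. Proof. exact: sqrtr_ge0. Qed.

Lemma r0_sqr : r0 ^+ 2 = gap x1 + alpha0 ^+ 2 / gamma0 / 2 * dot (x1 - xs) (x1 - xs).
Proof.
rewrite /r0 /initial_radius (F_fine x1D) (F_fine xs_dom) -EFinB /= enorm_sqr.
rewrite -/(gap x1) sqr_sqrtr; last first.
  by rewrite addr_ge0 ?gap_ge0// mulr_ge0 ?dot_ge0// divr_ge0 ?sqr_ge0// mulr_ge0// ltW.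
by congr (_ + _ * _); field; rewrite gt_eqF.
Qed.

Lemma rho_ge0 : 0 <= rho.
Proof. by rewrite divr_ge0 ?mulr_ge0 ?sqrtr_ge0 ?r0_ge0// ltW. Qed.

Lemma rho_sqr : alpha0 ^+ 2 / gamma0 * rho ^+ 2 = 2 * r0 ^+ 2.
Proof.
rewrite /rho !exprMn sqr_sqrtr; last by rewrite mulr_ge0// ltW.
by field; rewrite !gt_eqF.
Qed.

Lemma ball_segment r x y s : 0 <= s <= 1 ->
  dom_ball P xs r x -> dom_ball P xs r y ->
  dom_ball P xs r ((1 - s) *: x + s *: y).
Proof.
move=> s01 [xD xr] [yD yr]; split; first exact: (dom_convex Pproper Pconvex s01 xD yD).1.
have -> : (1 - s) *: x + s *: y - xs = (1 - s) *: (x - xs) + s *: (y - xs).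
  rewrite !scalerBr addrACA -opprD -scalerDl (_ : 1 - s + s = 1) ?scale1r//.
  by rewrite subrK.
exact: enorm_conv.
Qed.

Let SubSh : S `<=` Sh.
Proof.
move=> x [xD xr]; split=> //; apply: le_trans xr _.
have -> : (1 + gamma0 * LS) * Num.sqrt (2 * gamma0) * r0 / alpha0 = (1 + gamma0 * LS) * rho.
  by rewrite /rho !mulrA.
by rewrite ler_peMl ?rho_ge0// lerDl mulr_ge0// ltW.
Qed.

Let S_xs : S xs.
Proof.
split; first exact: xs_dom.
by rewrite subrr -(scale0r xs) enormZ normr0 mul0r rho_ge0.
Qed.

Lemma gamma_itv k : 0 < gamma0 * delta ^+ k <= gamma0.
Proof.
rewrite mulr_gt0 ?exprn_gt0//= ler_piMr ?(ltW gamma0_gt0)//.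
by rewrite exprn_ile1// ltW//; case/andP: delta_itv.
Qed.

(** What a line search that is about to try the exponent [k] has learnt: the refusal
    of [k - 1] shows that [gamma0 * delta ^ (k - 1)] exceeds [1 / LSh]. *)
Definition refused (k : nat) := (0 < k)%N -> 1 < gamma0 * delta ^+ k.-1 * LSh.

Lemma gamma_lower k : refused k ->
  Num.min gamma0 (delta * LSh^-1) <= gamma0 * delta ^+ k.
Proof.
case: k => [_|k /(_ isT) /= h]; first by rewrite expr0 mulr1 ge_min lexx.
rewrite ge_min; apply/orP; right; rewrite exprS mulrCA ler_pM2l//.
by rewrite -div1r ler_pdivrMr// ltW.
Qed.

Lemma q_itv : 0 < q <= 1.
Proof.
have m0 : 0 < Num.min gamma0 (delta * LSh^-1).
  by rewrite lt_min gamma0_gt0/= mulr_gt0// invr_gt0.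
rewrite sqrtr_gt0 mulr_gt0//= -[leRHS]sqrtr1 ler_sqrt//.
by apply: le_trans mu_gamma0; rewrite ler_pM2l// ge_min lexx.
Qed.

(** [Pi] is the product of the factors [1 - alpha] of the first [t] iterations. It
    bounds the potential from above and [a ^+ 2 / g] from below; only the bound of
    [Pi] itself depends on [q]. *)
Definition trajectory_bound (t : nat) (a g : R) (x z : 'rV[R]_n) :=
  [/\ 0 < a, 0 < g, mu * g <= a ^+ 2, S x /\ S z &
   exists Pi : R, [/\ 0 <= Pi <= (1 - q) ^+ t,
     gap x + a ^+ 2 / g / 2 * dot (z - xs) (z - xs) <= Pi * r0 ^+ 2 &
     Pi * (alpha0 ^+ 2 / gamma0) <= a ^+ 2 / g] ].

(** The factor [Pi] cancels: [A * |z - xs| ^ 2 <= 2 * Pi * r0 ^ 2], while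
    [A * rho ^ 2 >= 2 * Pi * r0 ^ 2]. No division by [Pi] occurs, which matters
    since [Pi = 0] after an iteration with [alpha = 1]. *)
Lemma in_S_of_potential (Pi A : R) x z : 0 < A -> D x -> D z ->
  gap x + A / 2 * dot (z - xs) (z - xs) <= Pi * r0 ^+ 2 ->
  Pi * (alpha0 ^+ 2 / gamma0) <= A -> S z.
Proof.
move=> A0 xD zD h hA; split=> //; apply: enorm_le_sqr; first exact: rho_ge0.
have gx := gap_ge0 xD; rewrite -(ler_pM2l A0).
have := ler_wpM2r (sqr_ge0 rho) hA; rewrite -mulrA rho_sqr; lra.
Qed.

Lemma trajectory_bound_start : trajectory_bound 0 alpha0 gamma0 x1 x1.
Proof.
have h : gap x1 + alpha0 ^+ 2 / gamma0 / 2 * dot (x1 - xs) (x1 - xs) <= 1 * r0 ^+ 2.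
  by rewrite mul1r r0_sqr.
have A0 : 0 < alpha0 ^+ 2 / gamma0 by rewrite divr_gt0// exprn_gt0.
have hA : 1 * (alpha0 ^+ 2 / gamma0) <= alpha0 ^+ 2 / gamma0 by rewrite mul1r.
have Sx := in_S_of_potential A0 x1D x1D h hA.
split=> //; last by exists 1; rewrite expr0 ler01 lexx.
case/andP: alpha0_itv => + _.
rewrite -(ler_pXn2r (ltn0Sn 1)) ?nnegrE ?sqrtr_ge0 ?(ltW alpha0_gt0)//.
by rewrite sqr_sqrtr// mulr_ge0// ltW.
Qed.

Lemma main_objectiveE (gamma alpha beta : R) y z :
  (fun w => gamma%:E * ((dot (grad f y) w)%:E + P w)
     + (alpha / 2 * enorm (w - beta *: y - (1 - beta) *: z) ^+ 2)%R%:E)%E =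
  prox_objective P gamma alpha (G y) (beta *: y + (1 - beta) *: z).
Proof.
apply/funext => w; rewrite /prox_objective gradE opprD addrA.
rewrite muleDr//.
by rewrite EFinD [RHS]addeA -EFinM; congr (_ + _)%E; rewrite addeC.
Qed.

Lemma check_objectiveE (gamma : R) v :
  (fun u => (gamma * dot (grad f v) u)%R%:E + gamma%:E * P u
                      + (2^-1 * enorm (u - v) ^+ 2)%R%:E)%E =
  prox_objective P gamma 1 (G v) v.
Proof.
apply/funext => w; rewrite /prox_objective gradE div1r EFinD addeA.
by congr (_ + _)%E; rewrite addeC.
Qed.

Lemma main_trial_exists k a g x z t : trajectory_bound t a g x z ->
  exists alpha gamma y z' x',
    main_trial f P mu gamma0 delta k a g x z alpha gamma y z' x'.
Proof.
move=> [a0 g0 _ _ _]; set gamma := gamma0 * delta ^+ k.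
have /andP[gam0 gam1] := gamma_itv k.
have mg1 : mu * gamma <= 1 by apply: le_trans mu_gamma0; rewrite ler_pM2l.
have [alpha [al01 E]] := alpha_exists a0 g0 gam0 mu0 mg1.
have /andP[al0 al1] := al01.
have [y yE] : exists y, extrapolation alpha (mu * gamma * alpha^-1) x z y.
  rewrite /extrapolation; case: (_ == 1); last by eexists.
  by exists ((1 - 0) *: x + 0 *: z); exists 0; rewrite ?lexx ?ler01.
pose beta := mu * gamma * alpha^-1.
have [z' z'min] := prox_exists (G y) (beta *: y + (1 - beta) *: z) gam0 al0
  Pproper Pclosed P_affine_minorant.
exists alpha, gamma, y, z', ((1 - alpha) *: x + alpha *: z'); split => //.
by rewrite main_objectiveE.
Qed.

Lemma check_trial_exists k v :
  exists gamma w, check_trial f P gamma0 delta k v gamma w.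
Proof.
have /andP[gam0 _] := gamma_itv k.
have [w wmin] := prox_exists (G v) v gam0 ltr01 Pproper Pclosed P_affine_minorant.
by exists (gamma0 * delta ^+ k), w; split => //; rewrite check_objectiveE.
Qed.

(** The descent lemma on [Sh] with constant [LSh] implies the line search test as
    soon as [gamma * LSh <= 1]. *)
Lemma refused_step gamma k y x : gamma = gamma0 * delta ^+ k -> S y -> Sh x ->
  ~ accepted f gamma y x -> refused k.+1.
Proof.
move=> -> yS xS; rewrite /refused => rej _ /=; rewrite ltNge; apply/negP => small.
have /andP[gam0 _] := gamma_itv k.
apply: rej; apply: (accepted_of_small (A := Sh) gam0 LSh_gt0 small) => //.
  by move=> u [].
by move=> s s01; apply: ball_segment => //; exact: SubSh.
Qed.

Lemma Sh_of_displacement gamma u : gamma <= gamma0 -> D u ->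
  enorm (u - xs) <= rho + gamma * (LS * rho) -> Sh u.
Proof.
move=> gg uD h; split=> //; apply: le_trans h _.
have -> : (1 + gamma0 * LS) * Num.sqrt (2 * gamma0) * r0 / alpha0 = (1 + gamma0 * LS) * rho.
  by rewrite /rho !mulrA.
rewrite mulrDl mul1r lerD2l -mulrA ler_wpM2r// mulr_ge0 ?rho_ge0//; exact: ltW.
Qed.

Lemma grad_dist y : S y -> enorm (G y - G xs) <= LS * rho.
Proof.
move=> yS; apply: le_trans (LS_lip yS S_xs) _.
by rewrite ler_pM2l//; exact: yS.2.
Qed.

Section MainTrial.
Variables (t k : nat) (a g alpha gamma : R) (x z y z' x' : 'rV[R]_n).
Hypothesis ok : trajectory_bound t a g x z.
Hypothesis trial : main_trial f P mu gamma0 delta k a g x z alpha gamma y z' x'.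
Let beta := mu * gamma * alpha^-1.

(** The proximal point satisfies [|z' - xs| <= rho + gamma / alpha * LS * rho],
    which can exceed the radius of [Sh]; in [x'] it carries the weight [alpha], which
    cancels the denominator. Hence [x'] lies in [Sh], though [z'] need not. *)
Lemma main_trial_facts :
  [/\ 0 < gamma <= gamma0, 0 < alpha <= 1, 0 <= beta <= 1, alpha * beta = mu * gamma &
  [/\ S y, D z', Sh x', is_argmin (prox_objective P gamma alpha (G y)
    (beta *: y + (1 - beta) *: z)) z' &
   y = (1 - alpha) *: x + alpha *: (beta *: y + (1 - beta) *: z)] ].
Proof.
have [a0 g0 _ [xS zS] _] := ok.
have [gE [al01 E] yE + x'E] := trial; rewrite main_objectiveE -/beta => zmin.
have gam := gamma_itv k; rewrite -gE in gam; have /andP[gam0 gam1] := gam.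
have /andP[al0 al1] := al01.
have [mgal _] := alpha_ge a0 g0 gam0 mu0 al01 E.
have be01 : 0 <= beta <= 1.
  rewrite divr_ge0 ?mulr_ge0 ?(ltW mu0) ?(ltW gam0) ?(ltW al0)//=.
  by rewrite ler_pdivrMr// mul1r.
have ab : alpha * beta = mu * gamma by rewrite mulrC divfK ?gt_eqF.
have [[s s01 ys] yE'] := extrapolationP al01 be01 yE.
have yS : S y by rewrite ys; exact: ball_segment.
have [z'D _] := prox_growth Pproper Pconvex gam0 al0 zmin.
split=> //; split=> //.
have al01' : 0 <= alpha <= 1 by rewrite ltW.
apply: (@Sh_of_displacement gamma) => //.
  by rewrite x'E; exact: (dom_convex Pproper Pconvex al01' xS.1 z'D).1.
have cS : S (beta *: y + (1 - beta) *: z).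
  have := ball_segment (s := 1 - beta) _ yS zS.
  rewrite (_ : 1 - (1 - beta) = beta); last by ring.
  by apply; case/andP: be01 => ? ?; rewrite subr_ge0 gerBl; apply/andP.
have := prox_nonexpansive Pproper Pconvex gam0 al0 zmin xs_dom xs_subgradient.
have := grad_dist yS; have := cS.2; have := xS.2.
have -> : x' - xs = (1 - alpha) *: (x - xs) + alpha *: (z' - xs).
  rewrite x'E !scalerBr addrACA -opprD -scalerDl subrK scale1r//.
move=> hx hc hg hz; apply: le_trans (enormD _ _) _.
rewrite !enormZ !ger0_norm ?subr_ge0 ?(ltW al0)//.
have al0' : 0 <= 1 - alpha by rewrite subr_ge0.
have := ler_wpM2l al0' hx; have := ler_wpM2l (ltW al0) hc.
have := ler_wpM2l (ltW gam0) hg; lra.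
Qed.

Lemma main_refused : ~ accepted f gamma y x' -> refused k.+1.
Proof.
have [_ _ _ _ [yS _ x'S _ _]] := main_trial_facts.
by apply: refused_step => //; case: trial.
Qed.

(** Here [refused k] bounds [gamma] below, hence [alpha] below by [q]. *)
Lemma main_accepted : refused k -> accepted f gamma y x' ->
  trajectory_bound t.+1 alpha gamma x' z'.
Proof.
move=> kok acc; have [a0 g0 mga [xS zS] [Pi [/andP[Pi0 Pi1] V A]]] := ok.
have [gE [al01 E] _ _ x'E] := trial.
have [/andP[gam0 _] _ be01 ab [yS z'D _ zmin yE]] := main_trial_facts.
have /andP[al0 al1] := al01.
have al01' : 0 <= alpha <= 1 by rewrite ltW.
have [_ /(_ mga) mgal] := alpha_ge a0 g0 gam0 mu0 al01 E.
have qal : q <= alpha.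
  rewrite -(ger0_norm (ltW al0)) -sqrtr_sqr ler_sqrt ?sqr_ge0//.
  by apply: le_trans mgal; rewrite ler_pM2l// gE gamma_lower.
have al1' : 0 <= 1 - alpha by rewrite subr_ge0.
have step := potential_step gam0 g0 al01 be01 ab E xS.1 yS.1 yE zmin x'E acc.
have V' : gap x' + alpha ^+ 2 / gamma / 2 * dot (z' - xs) (z' - xs) <=
    ((1 - alpha) * Pi) * r0 ^+ 2.
  by apply: le_trans step _; rewrite -[leRHS]mulrA ler_wpM2l.
have A' : (1 - alpha) * Pi * (alpha0 ^+ 2 / gamma0) <= alpha ^+ 2 / gamma.
  apply: (@le_trans _ _ ((1 - alpha) * (a ^+ 2 / g))).
    by rewrite -[leLHS]mulrA ler_wpM2l.
  rewrite ler_pdivlMr// mulrAC mulrA ler_pdivrMr// [leRHS]mulrC E.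
  have -> : (1 - alpha) * gamma * a ^+ 2 = (1 - alpha) * a ^+ 2 * gamma by ring.
  by rewrite lerDl !mulr_ge0// ltW.
have A0 : 0 < alpha ^+ 2 / gamma by rewrite divr_gt0// exprn_gt0.
have x'D : D x' by rewrite x'E; exact: (dom_convex Pproper Pconvex al01' xS.1 z'D).1.
have z'S := in_S_of_potential A0 x'D z'D V' A'.
split=> //; first by split=> //; rewrite x'E; exact: ball_segment.
exists ((1 - alpha) * Pi); split=> //.
rewrite mulr_ge0//= exprS; have /andP[_ q1] := q_itv.
by rewrite ler_pM// lerD2l lerN2.
Qed.

End MainTrial.

Notation C := (Num.sqrt (2 * Num.max gamma0^-1 (LSh * delta^-1))
                              + Num.sqrt (2 * gamma0) * LSh).

Section CheckTrial.
Variables (k : nat) (gamma : R) (v w : 'rV[R]_n).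
Hypothesis vS : S v.
Hypothesis trial : check_trial f P gamma0 delta k v gamma w.

Lemma check_trial_facts :
  [/\ 0 < gamma <= gamma0, is_argmin (prox_objective P gamma 1 (G v) v) w & Sh w].
Proof.
have [gE +] := trial; rewrite check_objectiveE => wmin.
have gam := gamma_itv k; rewrite -gE in gam; have /andP[gam0 gam1] := gam.
split=> //; apply: (@Sh_of_displacement gamma) => //.
  exact: (prox_growth Pproper Pconvex gam0 ltr01 wmin).1.
have := prox_nonexpansive Pproper Pconvex gam0 ltr01 wmin xs_dom xs_subgradient.
have := ler_wpM2l (ltW gam0) (grad_dist vS); have := vS.2; lra.
Qed.

Lemma check_refused : ~ accepted f gamma v w -> refused k.+1.
Proof.
have [_ _ wS] := check_trial_facts.
by apply: refused_step => //; case: trial.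
Qed.

(** In [residual_bound] the factor is monotone in [gamma ^-1] and in [gamma]; the
    former is bounded by the outcome of the line search, the latter by
    [gamma0]. *)
Lemma check_residual t a g z : trajectory_bound t a g v z -> refused k ->
  accepted f gamma v w ->
  enorm (gamma^-1 *: (v - w) + G w - G v)
    <= C * (r0 * Num.sqrt ((1 - q) ^+ t)).
Proof.
move=> [a0 g0 _ _ [Pi [/andP[Pi0 Pi1] V _]]] kok acc.
have [/andP[gam0 gam1] wmin wS] := check_trial_facts.
have lip := LSh_lip wS (SubSh vS).
apply: le_trans (residual_bound gam0 (ltW LSh_gt0) vS.1 wmin acc lip) _.
have gi : gamma^-1 <= Num.max gamma0^-1 (LSh * delta^-1).
  have := gamma_lower kok; rewrite -(proj1 trial) ge_min le_max => /orP[h|h].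
    by rewrite lef_pV2 ?posrE// h.
  apply/orP; right; rewrite -[LSh * _]invrK invfM invrK mulrC lef_pV2 ?posrE//.
  by rewrite mulr_gt0// invr_gt0.
apply: ler_pM; rewrite ?sqrtr_ge0//.
- by rewrite addr_ge0 ?mulr_ge0 ?sqrtr_ge0// ltW.
- apply: lerD; first by apply: ler_wsqrtr; rewrite ler_pM2l.
  by rewrite ler_pM2r//; apply: ler_wsqrtr; rewrite ler_pM2l.
rewrite -[r0 in leRHS]ger0_norm ?r0_ge0// -sqrtr_sqr -sqrtrM ?sqr_ge0//.
rewrite ler_sqrt; last by rewrite mulr_ge0 ?sqr_ge0// exprn_ge0// subr_ge0; case/andP: q_itv.
have A0 : 0 <= a ^+ 2 / g / 2 * dot (z - xs) (z - xs).
  by rewrite mulr_ge0 ?dot_ge0// divr_ge0// divr_ge0 ?sqr_ge0// ltW.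
have := ler_wpM2r (sqr_ge0 r0) Pi1; lra.
Qed.

End CheckTrial.

(** * Counting iterations and evaluations *)

Definition rate_steps := `|rate_term mu eps gamma0 delta r0 LSh|%N.
Definition refusals := `|ceilp (ln (gamma0 * LSh) / ln (1 / delta))|%N.

Lemma ceilp_ge0 (w : R) : 0 <= ceilp w.
Proof. by rewrite /ceilp le_max lexx orbT. Qed.

Lemma rate_stepsE : rate_term mu eps gamma0 delta r0 LSh = rate_steps%:Z.
Proof. by rewrite /rate_steps gez0_abs// ceilp_ge0. Qed.

Lemma refusalsE : ceilp (ln (gamma0 * LSh) / ln (1 / delta)) = refusals%:Z.
Proof. by rewrite /refusals gez0_abs// ceilp_ge0. Qed.

Lemma refused_le k : refused k -> (k <= refusals)%N.
Proof.
case: k => // k /(_ isT) /= h.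
by rewrite -ltz_nat -refusalsE; exact: linesearch_exponent.
Qed.

Lemma refusals_gt0 : 1 < gamma0 * LSh -> (0 < refusals)%N.
Proof.
move=> h; rewrite -ltz_nat -refusalsE.
by apply: linesearch_exponent => //; rewrite expr0 mulr1.
Qed.

Lemma late_check_stops t k a g v z gamma w : (0 < t)%N -> (rate_steps <= t)%N ->
  trajectory_bound t a g v z -> refused k -> check_trial f P gamma0 delta k v gamma w ->
  accepted f gamma v w -> stopping f eps gamma v w.
Proof.
move=> t0 Kt ok kok trial acc; rewrite /stopping gradE.
have [_ _ _ [vS _] _] := ok.
apply: le_trans (check_residual vS trial ok kok acc) _.
apply: rate_term_sufficient => //; [exact: q_itv|exact: r0_ge0| |].
  apply: ltr_wpDl; first exact: sqrtr_ge0.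
  by rewrite mulr_gt0// sqrtr_gt0 mulr_gt0.
by have := rate_stepsE; rewrite /rate_term => ->; rewrite lez_nat.
Qed.

(** After [m] completed iterations there were at most [m %/ M] calls of the
    residual procedure, and each line search made at most [refusals.+1] trials.
    No check at an iteration [j >= rate_steps] can have failed, so the method cannot
    run for more than [M] iterations past [rate_steps]. *)
Definition invariant (s : config R n) : Prop :=
  match s with
  | Main t k a g x z c =>
      [/\ (0 < t)%N, refused k, trajectory_bound t.-1 a g x z,
          (forall j, 0 < j < t -> M %| j -> j < rate_steps)%N &
          [/\ grads c <= t.-1 * refusals.+1 + t.-1 %/ M + k,
              proxs c <= (t.-1 + t.-1 %/ M) * refusals.+1 + k &
              tests c <= t.-1 %/ M]%N]
  | Check t k a g v z c =>
      [/\ (0 < t)%N /\ (M %| t)%N, refused k, trajectory_bound t a g v z,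
          (forall j, 0 < j < t -> M %| j -> j < rate_steps)%N &
          [/\ grads c <= t * refusals.+1 + t %/ M,
              proxs c <= (t + t.-1 %/ M) * refusals.+1 + k &
              tests c <= t.-1 %/ M]%N]
  | Done t w c =>
      [/\ (0 < t)%N /\ (M %| t)%N,
          residual_solution (fun x => (f x + P x)%E) eps w,
          (forall j, 0 < j < t -> M %| j -> j < rate_steps)%N &
          [/\ grads c <= t * refusals.+1 + t %/ M,
              proxs c <= (t + t %/ M) * refusals.+1 &
              tests c <= t %/ M]%N]
  end.

Lemma invariant_step s s' : invariant s ->
  step f P mu eps gamma0 delta M s s' -> invariant s'.
Proof.
move=> + st; case: st => [t k a g x z c alpha gamma y z' x' tr rej
  |t k a g x z c alpha gamma y z' x' tr acc ndvd
  |t k a g x z c alpha gamma y z' x' tr acc dvd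
  |t k a g v z c gamma w tr rej|t k a g v z c gamma w tr acc nstop
  |t k a g v z c gamma w tr acc stop] /=.
- move=> [t0 kok ok tj [cg cp ct]].
  by split=> //; [exact: main_refused ok tr rej | split=> //=; rewrite addnS ltnS].
- move=> [t0 kok ok tj [cg cp ct]]; have kle := refused_le kok.
  have st := main_accepted ok tr kok acc.
  case: t t0 ok tj cg cp ct st ndvd => // m _ /= ok tj cg cp ct st ndvd.
  have dM : (m.+1 %/ M = m %/ M)%N by rewrite divnS// (negbTE ndvd).
  split=> //.
    move=> j /andP[j0]; rewrite ltnS leq_eqVlt => /predU1P[->|jm].
      by rewrite (negbTE ndvd).
    by apply: tj; rewrite j0.
  by rewrite dM !(mulSn, addSn, addnS, mulnDl) in cg cp *;
    split=> /=; clear - kle cg cp ct; lia.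
- move=> [t0 kok ok tj [cg cp ct]]; have kle := refused_le kok.
  have st := main_accepted ok tr kok acc.
  case: t t0 ok tj cg cp ct st dvd => // m _ /= ok tj cg cp ct st dvd.
  have dM : (m.+1 %/ M = (m %/ M).+1)%N by rewrite divnS// dvd add1n.
  split=> //.
  by rewrite dM !(mulSn, addSn, addnS, mulnDl) in cg cp *;
    split=> /=; clear - kle cg cp ct; lia.
- move=> [[t0 dvd] kok ok tj [cg cp ct]].
  have [_ _ _ [vS _] _] := ok.
  by split=> //; [exact: check_refused vS tr rej | split=> //=; rewrite addnS ltnS].
- move=> [[t0 dvd] kok ok tj [cg cp ct]]; have kle := refused_le kok.
  have tK : (t < rate_steps)%N.
    rewrite ltnNge; apply/negP => Kt; apply: nstop.
    exact: late_check_stops ok kok tr acc.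
  case: t t0 ok tj cg cp ct tK dvd => // m _ /= ok tj cg cp ct tK dvd.
  have dM : (m.+1 %/ M = (m %/ M).+1)%N by rewrite divnS// dvd add1n.
  split=> //.
    move=> j /andP[j0]; rewrite ltnS leq_eqVlt => /predU1P[->//|jm].
    by apply: tj; rewrite j0.
  by rewrite dM !(mulSn, addSn, addnS, mulnDl) in cg cp *;
    split=> /=; clear - kle cg cp ct; lia.
- move=> [[t0 dvd] kok ok tj [cg cp ct]]; have kle := refused_le kok.
  have [_ _ _ [vS _] _] := ok.
  case: t t0 ok tj cg cp ct dvd => // m _ /= ok tj cg cp ct dvd.
  have dM : (m.+1 %/ M = (m %/ M).+1)%N by rewrite divnS// dvd add1n.
  split=> //.
    have [/andP[gam0 _] wmin _] := check_trial_facts vS tr.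
    apply: (stopping_residual gam0 wmin).
    by move: stop; rewrite /stopping gradE.
  by rewrite dM !(mulSn, addSn, addnS, mulnDl) in cg cp *;
    split=> /=; clear - kle cg cp ct; lia.
Qed.

Lemma reachable_invariant s :
  reachable (step f P mu eps gamma0 delta M) (start alpha0 gamma0 x1) s ->
  invariant s.
Proof.
elim=> [|s1 s2 _ IH st]; last exact: invariant_step IH st.
split=> //; first exact: trajectory_bound_start.
by move=> j; case: j.
Qed.

(** If [t > M + rate_steps], the last multiple of [M] before [t] would be a failed
    check at an iteration [>= rate_steps]. *)
Lemma iteration_le t : (forall j, 0 < j < t -> M %| j -> j < rate_steps)%N ->
  (t <= M + rate_steps)%N.
Proof.
move=> tj; rewrite leqNgt; apply/negP => ht.
have := tj (t.-1 %/ M * M)%N; rewrite dvdn_mull//.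
have := divn_eq t.-1 M; have := ltn_pmod t.-1 M_gt0.
set u := (t.-1 %/ M * M)%N; set r := (_ %% _)%N.
clear -ht; lia.
Qed.

(** Every transition costs exactly one evaluation of the proximal operator, so an
    infinite execution would exceed every bound on [proxs]. *)
Lemma step_proxs (rel := step f P mu eps gamma0 delta M) (run : nat -> config R n) :
  (forall i, rel (run i) (run i.+1)) ->
  forall i, match run i with
            | Main _ _ _ _ _ _ c | Check _ _ _ _ _ _ c | Done _ _ c => (i <= proxs c)%N
            end.
Proof.
move=> h; elim=> [|i IH]; first by case: (run 0%N).
by move: IH; case: (h i).
Qed.

Lemma algorithm_terminates :
  terminates (step f P mu eps gamma0 delta M) (start alpha0 gamma0 x1).
Proof.
split=> [s /reachable_invariant|[run [run0 hrun]]].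
  case: s => [t k a g x z c|t k a g v z c|t w c] /=; last by left; exists t, w, c.
    move=> [t0 kok ok _ _]; right.
    have [alpha [gamma [y [z' [x' tr]]]]] := main_trial_exists k ok.
    have [acc|rej] := pselect (accepted f gamma y x').
      have [dvd|ndvd] := boolP (M %| t)%N.
        by eexists; exact: main_check tr acc dvd.
      by eexists; exact: main_next tr acc ndvd.
    by eexists; exact: main_reject tr rej.
  move=> [_ _ _ _ _]; right.
  have [gamma [w tr]] := check_trial_exists k v.
  have [acc|rej] := pselect (accepted f gamma v w); last first.
    by eexists; exact: check_reject tr rej.
  have [stop|nstop] := pselect (stopping f eps gamma v w).
    by eexists; exact: check_stop tr acc stop.
  by eexists; exact: check_continue tr acc nstop.
have reach i : reachable (step f P mu eps gamma0 delta M) (start alpha0 gamma0 x1) (run i).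
  by elim: i => [|i IH]; [rewrite run0; exact: reachable_refl | exact: reachable_step IH (hrun i)].
pose b := ((M + rate_steps + (M + rate_steps)) * refusals.+1 + refusals)%N.
have divle (m : nat) : (m %/ M <= m)%N by exact: leq_div.
have bound t m k c : (m <= t)%N -> (t <= M + rate_steps)%N -> (k <= refusals)%N ->
    (c <= (t + m %/ M) * refusals.+1 + k)%N -> (c <= b)%N.
  move=> mt tK kr cp; apply: leq_trans cp _; apply: leq_add => //.
  rewrite leq_mul2r; apply/orP; right; apply: leq_add => //.
  by apply: leq_trans (divle m) _; apply: leq_trans mt tK.
have := step_proxs hrun b.+1; have := reachable_invariant (reach b.+1).
case: (run b.+1) => [t k a g x z c|t k a g v z c|t w c] /=.
- move=> [t0 /refused_le kr _ /iteration_le tK [_ cp _]].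
  by apply/negP; rewrite -leqNgt; apply: bound cp => //; exact: leq_trans (leq_pred _) tK.
- move=> [_ /refused_le kr _ /iteration_le tK [_ cp _]].
  by apply/negP; rewrite -leqNgt; apply: bound cp => //; apply: leq_pred.
- move=> [_ _ /iteration_le tK [_ cp _]].
  by apply/negP; rewrite -leqNgt; apply: (@bound t t 0%N) => //; rewrite addn0.
Qed.

(** The calls of the residual procedure number [t %/ M = t / M], which is where the
    factor [1 + 1 / M] comes from. *)
Lemma le_evaluation_bound t (c : nat) : (M %| t)%N -> (t <= M + rate_steps)%N ->
  (c <= (t + t %/ M) * refusals.+1)%N ->
  c%:R <= evaluation_bound mu eps gamma0 delta r0 LSh M.
Proof.
move=> dvd tK cle; rewrite /evaluation_bound rate_stepsE refusalsE.
apply: le_trans (_ : ((t + t %/ M) * refusals.+1)%:R <= _); first by rewrite ler_nat.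
have MR : (0 : R) < M%:R by rewrite ltr0n.
have -> : 1 + refusals%:Z = refusals.+1%:Z by rewrite -add1n PoszD.
rewrite -PoszD -!pmulrn natrM natrD.
rewrite ler_wpM2r ?ler0n//.
have -> : (t %/ M)%:R = M%:R^-1 * t%:R :> R.
  by rewrite -[in RHS](divnK dvd) natrM mulrC mulfK ?gt_eqF.
by rewrite -[X in X + _]mul1r -mulrDl ler_wpM2l ?ler_nat.
Qed.

Lemma algorithm_output t w c :
  reachable (step f P mu eps gamma0 delta M) (start alpha0 gamma0 x1) (Done t w c) ->
  [/\ residual_solution (fun x => (f x + P x)%E) eps w,
      t%:Z <= iteration_bound mu eps gamma0 delta r0 LSh M,
      (grads c)%:R <= evaluation_bound mu eps gamma0 delta r0 LSh M,
      (proxs c)%:R <= evaluation_bound mu eps gamma0 delta r0 LSh M &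
      1 < gamma0 * LSh ->
        (grads c + tests c)%:R <= evaluation_bound mu eps gamma0 delta r0 LSh M].
Proof.
move=> /reachable_invariant /= [[t0 dvd] res /iteration_le tK [cg cp ct]].
split=> //.
- by rewrite /iteration_bound rate_stepsE -PoszD lez_nat.
- apply: le_evaluation_bound dvd tK _; apply: leq_trans cg _.
  by rewrite mulnDl leq_add2l leq_pmulr.
- exact: le_evaluation_bound dvd tK cp.
(* each call of the residual procedure is charged [refusals.+1 >= 2] evaluations,
   which covers its two gradients *)
- move=> /refusals_gt0 refusal.
  apply: le_evaluation_bound dvd tK _; apply: leq_trans (leq_add cg ct) _.
  by rewrite mulnDl -addnA leq_add2l addnn -muln2 leq_mul2l ltnS refusal orbT.
Qed.

End Algorithm.
End Problem.

Theorem theorem3 (R : realType) (n : nat) (f P : 'rV[R]_n -> \bar R)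
    (xs : 'rV[R]_n) (mu : R)
    (eps gamma0 alpha0 delta : R) (M : nat) (x1 : 'rV[R]_n) (LS LSh : R) :
  let F := fun x => (f x + P x)%E in
  let r0 := initial_radius F alpha0 gamma0 x1 xs in
  let S := dom_ball P xs (Num.sqrt (2 * gamma0) * r0 / alpha0) in
  let Sh := dom_ball P xs
              ((1 + gamma0 * LS) * Num.sqrt (2 * gamma0) * r0 / alpha0) in
  let T := iteration_bound mu eps gamma0 delta r0 LSh M in
  let N := evaluation_bound mu eps gamma0 delta r0 LSh M in
  let run := step f P mu eps gamma0 delta M in
  let s1 := start alpha0 gamma0 x1 in
  (* the problem *)
  proper_closed_convex f -> proper_closed_convex P ->
  (forall x, closure (dom P) x -> ediff f x) ->
  locally_lipschitz_grad f (closure (dom P)) ->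
  F xs \is a fin_num -> is_argmin F xs ->
  0 < mu -> convexity_parameter mu f (dom P) ->
  (* the input *)
  0 < eps -> 0 < gamma0 <= mu^-1 ->
  0 < alpha0 -> Num.sqrt (mu * gamma0) <= alpha0 <= 1 ->
  0 < delta < 1 -> (0 < M)%N -> dom P x1 ->
  (* the constants *)
  0 < LS -> lipschitz_const LS S (grad f) ->
  0 < LSh -> lipschitz_const LSh Sh (grad f) ->
  (* the conclusion *)
  terminates run s1 /\
  forall t w c, reachable run s1 (Done t w c) ->
    [/\ residual_solution F eps w,
        t%:Z <= T,
        (grads c)%:R <= N,
        (proxs c)%:R <= N &
        1 < gamma0 * LSh -> (grads c + tests c)%:R <= N].
Proof.
move=> F r0 S Sh T N run s1 [[fNy _] _ _] [Pproper Pclosed Pconvex].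
move=> fdiff flip Fxs xsmin mu0 fconv eps0 gamma0_itv alpha0_gt0 alpha0_itv.
move=> delta_itv M0 x1D LS0 LSlip LSh0 LShlip.
split.
  exact: (algorithm_terminates fNy Pproper Pclosed Pconvex fdiff flip Fxs xsmin mu0
    fconv erefl eps0 gamma0_itv alpha0_gt0 alpha0_itv delta_itv M0 x1D LS0 LSlip
    LSh0 LShlip).
by move=> t w c; exact: (algorithm_output fNy Pproper Pconvex fdiff flip Fxs xsmin mu0
  fconv erefl eps0 gamma0_itv alpha0_gt0 alpha0_itv delta_itv M0 x1D LS0 LSlip
  LSh0 LShlip).
Qed.
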